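(* Let $\mathbf{C}$ be a 2-category, $C,C'$ pseudo-categories in $\mathbf{C}$, $F,G,H:C\to C'$ pseudo-functors, and $T=(t,\tau):F\to G$, $S=(s,\sigma):G\to H$ pseudo-natural transformations. Then the vertical composition $$S\otimes T=\big(m'\langle s,t\rangle,\ \sigma\otimes\tau\big),$$ where $$\sigma\otimes\tau=\big(\alpha'\langle sc,tc,F_1\rangle\big)\cdot\big(m'\langle 1_{sc},\tau\rangle\big)\cdot\big(\alpha'^{-1}\langle sc,G_1,td\rangle\big)\cdot\big(m'\langle\sigma,1_{td}\rangle\big)\cdot\big(\alpha'\langle H_1,sd,td\rangle\big),$$ is well defined, i.e. $S\otimes T$ is a pseudo-natural transformation from $F$ to $H$.
   Context: Conventions. In a 2-category $\mathbf{C}$, $\circ$ (or juxtaposition) denotes composition of morphisms, horizontal composition of 2-cells and whiskering; $\cdot$ denotes vertical composition of 2-cells ($\beta\cdot\alpha$ means first $\alpha$, then $\beta$). All pullbacks mentioned are assumed to exist and are strict pullbacks in the 2-categorical sense (universal also for 2-cells), so that $\langle -,-\rangle$ denotes the induced morphism or 2-cell into a pullback (a morphism inside a pairing with a 2-cell stands for its identity 2-cell). For $d,c:C_1\to C_0$, the pullback $C_1\times_{C_0}C_1$ has projections $\pi_1,\pi_2$ with $d\pi_1=c\pi_2$; similarly for triple and quadruple pullbacks. We write $f\times g$ (with or without subscript) for $\langle f\pi_1,g\pi_2\rangle$, etc. Pseudo-category. A pseudo-category in $\mathbf{C}$ is a system $C=(C_0,C_1,d,c,e,m,\alpha,\lambda,\rho)$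 where $C_0,C_1$ are objects, $d,c:C_1\to C_0$, $e:C_0\to C_1$, $m:C_1\times_{C_0}C_1\to C_1$ are morphisms, and $\alpha:m(1_{C_1}\times_{C_0}m)\to m(m\times_{C_0}1_{C_1})$, $\lambda:m\langle ec,1_{C_1}\rangle\to 1_{C_1}$, $\rho:m\langle 1_{C_1},ed\rangle\to 1_{C_1}$ are invertible 2-cells, such that - $de=1_{C_0}=ce$; $dm=d\pi_2$, $cm=c\pi_1$; - $d\circ\lambda=1_d=d\circ\rho$, $c\circ\lambda=1_c=c\circ\rho$; $d\circ\alpha=1_{d\pi_3}$, $c\circ\alpha=1_{c\pi_1}$; $\lambda\circ e=\rho\circ e$; - (pentagon) $(\alpha\circ(m\times 1\times 1))\cdot(\alpha\circ(1\times 1\times m))=(m\circ(\alpha\times 1))\cdot(\alpha\circ(1\times m\times 1))\cdot(m\circ(1\times\alpha))$; - (triangle) $(m\circ(\rho\times 1))\cdot(\alpha\circ(1\times\langle ec,1\rangle))=m\circ(1\times\lambda)$. The structure of $C'$ is denoted by the same letters with primes. Pseudo-functor. A pseudo-functor $F:C\to C'$ is a system $F=(F_0,F_1,\mu_F,\varepsilon_F)$ with morphisms $F_0:C_0\to C_0'$, $F_1:C_1\to C_1'$ and invertible 2-cells $\mu=\mu_F:F_1m\to m'(F_1\times_{F_0}F_1)$, $\varepsilon=\varepsilon_F:F_1e\to e'F_0$ such that - $d'F_1=F_0d$, $c'F_1=F_0c$; $d'\circ\mu=1_{F_0d\pi_2}$, $c'\circ\mu=1_{F_0c\pi_1}$;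 $d'\circ\varepsilon=1_{F_0}=c'\circ\varepsilon$; - $(\alpha'\circ(F_1\times F_1\times F_1))\cdot(m'\circ(1_{F_1}\times\mu))\cdot(\mu\circ(1\times m))=(m'\circ(\mu\times 1_{F_1}))\cdot(\mu\circ(m\times 1))\cdot(F_1\circ\alpha)$; - $F_1\circ\rho=(\rho'\circ F_1)\cdot(m'\langle 1_{F_1},\varepsilon\circ d\rangle)\cdot(\mu\circ\langle 1,ed\rangle)$; - $F_1\circ\lambda=(\lambda'\circ F_1)\cdot(m'\langle\varepsilon\circ c,1_{F_1}\rangle)\cdot(\mu\circ\langle ec,1\rangle)$. Pseudo-natural transformation. For pseudo-functors $F,G:C\to C'$, a pseudo-natural transformation $T:F\to G$ is a pair $T=(t,\tau)$ with $t:C_0\to C_1'$ a morphism and $\tau:m'\langle G_1,td\rangle\to m'\langle tc,F_1\rangle$ an invertible 2-cell such that - $d't=F_0$, $c't=G_0$; $d'\circ\tau=1_{d'F_1}$, $c'\circ\tau=1_{c'G_1}$; - as 2-cells between morphisms $C_1\times_{C_0}C_1\to C_1'$, $(\alpha'\langle tc\pi_1,F_1\pi_1,F_1\pi_2\rangle)\cdot(m'\langle tc\pi_1,\mu_F\rangle)\cdot(\tau\circ m)\cdot(m'\langle\mu_G^{-1},td\pi_2\rangle)=(m'\langle\tau\pi_1,F_1\pi_2\rangle)\cdot(\alpha'\langle G_1\pi_1,tc\pi_2,F_1\pi_2\rangle)\cdot(m'\langle G_1\pi_1,\tau\pi_2\rangle)\cdot(\alpha'^{-1}\langle G_1\pi_1,G_1\pi_2,td\pi_2\rangle)$;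 - $(\lambda'\circ t)\cdot(m'\langle\varepsilon_G,1_t\rangle)=(\rho'\circ t)\cdot(m'\langle 1_t,\varepsilon_F\rangle)\cdot(\tau\circ e)$. *)

(* Defs.v *)
From Stdlib Require Import ssreflect ClassicalEpsilon.

Set Implicit Arguments.
Unset Strict Implicit.
Unset Printing Implicit Defensive.

Declare Scope cell_scope.
Delimit Scope cell_scope with cell.
Local Open Scope cell_scope.

(* A strict 2-category.  The hom-categories are given by a type of 1-cells, a
   type of 2-cells, and source and target functions, so that 2-cells between
   equal 1-cells need no transport.  The vertical composite [vcomp b a] (first
   [a], then [b]) is a total function, but it is meaningful, and constrained,
   only when [tgt a = src b]; every partial composition extends to such a
   function, e.g. by [b]. *)
Record TwoCat := {
  ob : Type;
  hom : ob -> ob -> Type;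
  cell : ob -> ob -> Type;
  idm : forall A, hom A A;
  comp : forall A B C, hom B C -> hom A B -> hom A C;
  src : forall A B, cell A B -> hom A B;
  tgt : forall A B, cell A B -> hom A B;
  idc : forall A B, hom A B -> cell A B;
  vcomp : forall A B, cell A B -> cell A B -> cell A B;
  hcomp : forall A B C, cell B C -> cell A B -> cell A C;
  compA : forall A B C D (h : hom C D) (g : hom B C) (f : hom A B),
    comp h (comp g f) = comp (comp h g) f;
  comp1m : forall A B (f : hom A B), comp (idm B) f = f;
  compm1 : forall A B (f : hom A B), comp f (idm A) = f;
  src_idc : forall A B (f : hom A B), src (idc f) = f;
  tgt_idc : forall A B (f : hom A B), tgt (idc f) = f;
  src_vcomp : forall A B (b a : cell A B),
    tgt a = src b -> src (vcomp b a) = src a;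
  tgt_vcomp : forall A B (b a : cell A B),
    tgt a = src b -> tgt (vcomp b a) = tgt b;
  vcompA : forall A B (c b a : cell A B), tgt a = src b -> tgt b = src c ->
    vcomp c (vcomp b a) = vcomp (vcomp c b) a;
  vcomp1c : forall A B (a : cell A B), vcomp (idc (tgt a)) a = a;
  vcompc1 : forall A B (a : cell A B), vcomp a (idc (src a)) = a;
  src_hcomp : forall A B C (b : cell B C) (a : cell A B),
    src (hcomp b a) = comp (src b) (src a);
  tgt_hcomp : forall A B C (b : cell B C) (a : cell A B),
    tgt (hcomp b a) = comp (tgt b) (tgt a);
  hcompA : forall A B C D (c : cell C D) (b : cell B C) (a : cell A B),
    hcomp c (hcomp b a) = hcomp (hcomp c b) a;
  hcomp1c : forall A B (a : cell A B), hcomp (idc (idm B)) a = a;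
  hcompc1 : forall A B (a : cell A B), hcomp a (idc (idm A)) = a;
  hcomp_idc : forall A B C (g : hom B C) (f : hom A B),
    hcomp (idc g) (idc f) = idc (comp g f);
  interchange : forall A B C (b' b : cell B C) (a' a : cell A B),
    tgt b = src b' -> tgt a = src a' ->
    hcomp (vcomp b' b) (vcomp a' a) = vcomp (hcomp b' a') (hcomp b a)
}.

Arguments idm {t} A.

Notation "g ∘ f" := (comp g f) (at level 40, left associativity) : cell_scope.
Notation "'𝟙' f" := (idc f) (at level 9, f at level 8) : cell_scope.
Notation "b · a" := (vcomp b a) (at level 45, left associativity) : cell_scope.
Notation "f ◃ a" := (hcomp (idc f) a) (at level 40, left associativity) : cell_scope.
Notation "a ▹ f" := (hcomp a (idc f)) (at level 40, left associativity) : cell_scope.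

Definition has_type (K : TwoCat) (A B : ob K) (a : cell A B) (f g : hom A B) : Prop :=
  src a = f /\ tgt a = g.
Notation "a ∈ f ⇒ g" := (has_type a f g) (at level 70, f at next level) : cell_scope.

Definition is_inverse (K : TwoCat) (A B : ob K) (a b : cell A B) : Prop :=
  b ∈ tgt a ⇒ src a /\ b · a = 𝟙 (src a) /\ a · b = 𝟙 (tgt a).

Definition invertible (K : TwoCat) (A B : ob K) (a : cell A B) : Prop :=
  exists b, is_inverse a b.

(* The inverse of an invertible 2-cell (it is unique); used for these only. *)
Definition vinv (K : TwoCat) (A B : ob K) (a : cell A B) : cell A B :=
  epsilon (inhabits a) (is_inverse a).
Notation "a ⁻¹" := (vinv a) (at level 2, left associativity) : cell_scope.

(* Strict 2-categorical limits of C1 -d-> C0 <-c- C1, of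
   C1 -d-> C0 <-c- C1 -d-> C0 <-c- C1, and of the similar diagram with four
   copies of C1.  The source and target of the 2-cell [u] below are determined
   by those of the given 2-cells, by uniqueness for 1-cells. *)
Record is_pullback2 (K : TwoCat) (C0 C1 : ob K) (d c : hom C1 C0)
    (P : ob K) (p1 p2 : hom P C1) : Prop := {
  pb2_comm : d ∘ p1 = c ∘ p2;
  pb2_hom : forall X (f1 f2 : hom X C1), d ∘ f1 = c ∘ f2 ->
    exists! u : hom X P, p1 ∘ u = f1 /\ p2 ∘ u = f2;
  pb2_cell : forall X (a1 a2 : cell X C1), d ◃ a1 = c ◃ a2 ->
    exists! u : cell X P, p1 ◃ u = a1 /\ p2 ◃ u = a2
}.

Record is_pullback3 (K : TwoCat) (C0 C1 : ob K) (d c : hom C1 C0)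
    (P : ob K) (p1 p2 p3 : hom P C1) : Prop := {
  pb3_comm : d ∘ p1 = c ∘ p2 /\ d ∘ p2 = c ∘ p3;
  pb3_hom : forall X (f1 f2 f3 : hom X C1), d ∘ f1 = c ∘ f2 -> d ∘ f2 = c ∘ f3 ->
    exists! u : hom X P, p1 ∘ u = f1 /\ p2 ∘ u = f2 /\ p3 ∘ u = f3;
  pb3_cell : forall X (a1 a2 a3 : cell X C1), d ◃ a1 = c ◃ a2 -> d ◃ a2 = c ◃ a3 ->
    exists! u : cell X P, p1 ◃ u = a1 /\ p2 ◃ u = a2 /\ p3 ◃ u = a3
}.

Record is_pullback4 (K : TwoCat) (C0 C1 : ob K) (d c : hom C1 C0)
    (P : ob K) (p1 p2 p3 p4 : hom P C1) : Prop := {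
  pb4_comm : d ∘ p1 = c ∘ p2 /\ d ∘ p2 = c ∘ p3 /\ d ∘ p3 = c ∘ p4;
  pb4_hom : forall X (f1 f2 f3 f4 : hom X C1),
    d ∘ f1 = c ∘ f2 -> d ∘ f2 = c ∘ f3 -> d ∘ f3 = c ∘ f4 ->
    exists! u : hom X P,
      p1 ∘ u = f1 /\ p2 ∘ u = f2 /\ p3 ∘ u = f3 /\ p4 ∘ u = f4;
  pb4_cell : forall X (a1 a2 a3 a4 : cell X C1),
    d ◃ a1 = c ◃ a2 -> d ◃ a2 = c ◃ a3 -> d ◃ a3 = c ◃ a4 ->
    exists! u : cell X P,
      p1 ◃ u = a1 /\ p2 ◃ u = a2 /\ p3 ◃ u = a3 /\ p4 ◃ u = a4
}.

(* The part (C0, C1, d, c, e) of a pseudo-category, with its pullbacks. *)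
Record IGraph (K : TwoCat) := {
  C0 : ob K;
  C1 : ob K;
  gd : hom C1 C0;
  gc : hom C1 C0;
  ge : hom C0 C1;
  gde : gd ∘ ge = idm C0;
  gce : gc ∘ ge = idm C0;
  C2 : ob K;
  p21 : hom C2 C1;
  p22 : hom C2 C1;
  C2P : is_pullback2 gd gc p21 p22;
  C3 : ob K;
  p31 : hom C3 C1;
  p32 : hom C3 C1;
  p33 : hom C3 C1;
  C3P : is_pullback3 gd gc p31 p32 p33;
  C4 : ob K;
  p41 : hom C4 C1;
  p42 : hom C4 C1;
  p43 : hom C4 C1;
  p44 : hom C4 C1;
  C4P : is_pullback4 gd gc p41 p42 p43 p44
}.

Lemma gc_ged (K : TwoCat) (G : IGraph K) (X : ob K) (f : hom X (C1 G)) :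
  gd G ∘ f = gc G ∘ (ge G ∘ (gd G ∘ f)).
Proof. by rewrite compA gce comp1m. Qed.

Lemma inh2 (K : TwoCat) (G : IGraph K) (X : ob K) (f : hom X (C1 G)) :
  inhabited (hom X (C2 G)).
Proof. by case: (pb2_hom (C2P G) (gc_ged f)) => u _. Qed.

Lemma inh3 (K : TwoCat) (G : IGraph K) (X : ob K) (f : hom X (C1 G)) :
  inhabited (hom X (C3 G)).
Proof. by case: (pb3_hom (C3P G) (gc_ged f) (gc_ged _)) => u _. Qed.

Lemma inh4 (K : TwoCat) (G : IGraph K) (X : ob K) (f : hom X (C1 G)) :
  inhabited (hom X (C4 G)).
Proof. by case: (pb4_hom (C4P G) (gc_ged f) (gc_ged _) (gc_ged _)) => u _. Qed.

Definition inhc (K : TwoCat) (A B : ob K) (i : inhabited (hom A B)) :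
  inhabited (cell A B) := let: inhabits f := i in inhabits (𝟙 f).

(* The 1-cells and 2-cells induced by the universal properties.  As functions
   of arbitrary components they are meaningful on compatible ones only. *)
Definition pair2 (K : TwoCat) (G : IGraph K) (X : ob K)
    (f1 f2 : hom X (C1 G)) : hom X (C2 G) :=
  epsilon (inh2 f1) (fun u => p21 G ∘ u = f1 /\ p22 G ∘ u = f2).

Definition pair3 (K : TwoCat) (G : IGraph K) (X : ob K)
    (f1 f2 f3 : hom X (C1 G)) : hom X (C3 G) :=
  epsilon (inh3 f1) (fun u => p31 G ∘ u = f1 /\ p32 G ∘ u = f2 /\ p33 G ∘ u = f3).

Definition pair4 (K : TwoCat) (G : IGraph K) (X : ob K)
    (f1 f2 f3 f4 : hom X (C1 G)) : hom X (C4 G) :=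
  epsilon (inh4 f1) (fun u =>
    p41 G ∘ u = f1 /\ p42 G ∘ u = f2 /\ p43 G ∘ u = f3 /\ p44 G ∘ u = f4).

Definition cpair2 (K : TwoCat) (G : IGraph K) (X : ob K)
    (a1 a2 : cell X (C1 G)) : cell X (C2 G) :=
  epsilon (inhc (inh2 (src a1))) (fun u => p21 G ◃ u = a1 /\ p22 G ◃ u = a2).

Definition cpair3 (K : TwoCat) (G : IGraph K) (X : ob K)
    (a1 a2 a3 : cell X (C1 G)) : cell X (C3 G) :=
  epsilon (inhc (inh3 (src a1))) (fun u =>
    p31 G ◃ u = a1 /\ p32 G ◃ u = a2 /\ p33 G ◃ u = a3).

Notation "⟨ f , g ⟩" := (pair2 f g) : cell_scope.
Notation "⟨ f , g , h ⟩" := (pair3 f g h) : cell_scope.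
Notation "⟨ f , g , h , k ⟩" := (pair4 f g h k) : cell_scope.
Notation "⟪ a , b ⟫" := (cpair2 a b) : cell_scope.
Notation "⟪ a , b , c ⟫" := (cpair3 a b c) : cell_scope.

Record PseudoCat (K : TwoCat) := {
  graph :> IGraph K;
  mul : hom (C2 graph) (C1 graph);
  assoc : cell (C3 graph) (C1 graph);
  lun : cell (C1 graph) (C1 graph);
  run : cell (C1 graph) (C1 graph);
  gd_mul : gd graph ∘ mul = gd graph ∘ p22 graph;
  gc_mul : gc graph ∘ mul = gc graph ∘ p21 graph;
  assoc_type : assoc ∈
    mul ∘ ⟨p31 graph, mul ∘ ⟨p32 graph, p33 graph⟩⟩ ⇒
    mul ∘ ⟨mul ∘ ⟨p31 graph, p32 graph⟩, p33 graph⟩;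
  lun_type : lun ∈ mul ∘ ⟨ge graph ∘ gc graph, idm (C1 graph)⟩ ⇒ idm (C1 graph);
  run_type : run ∈ mul ∘ ⟨idm (C1 graph), ge graph ∘ gd graph⟩ ⇒ idm (C1 graph);
  assoc_inv : invertible assoc;
  lun_inv : invertible lun;
  run_inv : invertible run;
  gd_lun : gd graph ◃ lun = 𝟙 (gd graph);
  gd_run : gd graph ◃ run = 𝟙 (gd graph);
  gc_lun : gc graph ◃ lun = 𝟙 (gc graph);
  gc_run : gc graph ◃ run = 𝟙 (gc graph);
  gd_assoc : gd graph ◃ assoc = 𝟙 (gd graph ∘ p33 graph);
  gc_assoc : gc graph ◃ assoc = 𝟙 (gc graph ∘ p31 graph);
  lun_run_ge : lun ▹ ge graph = run ▹ ge graph;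
  pentagon :
    let π1 := p41 graph in let π2 := p42 graph in
    let π3 := p43 graph in let π4 := p44 graph in
    (assoc ▹ ⟨mul ∘ ⟨π1, π2⟩, π3, π4⟩) · (assoc ▹ ⟨π1, π2, mul ∘ ⟨π3, π4⟩⟩)
    = (mul ◃ ⟪assoc ▹ ⟨π1, π2, π3⟩, 𝟙 π4⟫)
      · (assoc ▹ ⟨π1, mul ∘ ⟨π2, π3⟩, π4⟩)
      · (mul ◃ ⟪𝟙 π1, assoc ▹ ⟨π2, π3, π4⟩⟫);
  triangle :
    let π1 := p21 graph in let π2 := p22 graph in
    (mul ◃ ⟪run ▹ π1, 𝟙 π2⟫) · (assoc ▹ ⟨π1, ge graph ∘ gc graph ∘ π2, π2⟩)
    = mul ◃ ⟪𝟙 π1, lun ▹ π2⟫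
}.

Record PseudoFunctor (K : TwoCat) (C C' : PseudoCat K) := {
  F0 : hom (C0 C) (C0 C');
  F1 : hom (C1 C) (C1 C');
  mu : cell (C2 C) (C1 C');
  eps : cell (C0 C) (C1 C');
  gd_F1 : gd C' ∘ F1 = F0 ∘ gd C;
  gc_F1 : gc C' ∘ F1 = F0 ∘ gc C;
  mu_type : mu ∈ F1 ∘ mul C ⇒ mul C' ∘ ⟨F1 ∘ p21 C, F1 ∘ p22 C⟩;
  eps_type : eps ∈ F1 ∘ ge C ⇒ ge C' ∘ F0;
  mu_inv : invertible mu;
  eps_inv : invertible eps;
  gd_mu : gd C' ◃ mu = 𝟙 (F0 ∘ gd C ∘ p22 C);
  gc_mu : gc C' ◃ mu = 𝟙 (F0 ∘ gc C ∘ p21 C);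
  gd_eps : gd C' ◃ eps = 𝟙 F0;
  gc_eps : gc C' ◃ eps = 𝟙 F0;
  mu_assoc :
    let π1 := p31 C in let π2 := p32 C in let π3 := p33 C in
    (assoc C' ▹ ⟨F1 ∘ π1, F1 ∘ π2, F1 ∘ π3⟩)
      · (mul C' ◃ ⟪𝟙 (F1 ∘ π1), mu ▹ ⟨π2, π3⟩⟫)
      · (mu ▹ ⟨π1, mul C ∘ ⟨π2, π3⟩⟩)
    = (mul C' ◃ ⟪mu ▹ ⟨π1, π2⟩, 𝟙 (F1 ∘ π3)⟫)
      · (mu ▹ ⟨mul C ∘ ⟨π1, π2⟩, π3⟩)
      · (F1 ◃ assoc C);
  mu_run :
    F1 ◃ run C
    = (run C' ▹ F1) · (mul C' ◃ ⟪𝟙 F1, eps ▹ gd C⟫)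
      · (mu ▹ ⟨idm (C1 C), ge C ∘ gd C⟩);
  mu_lun :
    F1 ◃ lun C
    = (lun C' ▹ F1) · (mul C' ◃ ⟪eps ▹ gc C, 𝟙 F1⟫)
      · (mu ▹ ⟨ge C ∘ gc C, idm (C1 C)⟩)
}.

Record Trans (K : TwoCat) (C C' : PseudoCat K) := MkTrans {
  tr1 : hom (C0 C) (C1 C');
  tr2 : cell (C1 C) (C1 C')
}.

Record is_pseudo_nat (K : TwoCat) (C C' : PseudoCat K) (F G : PseudoFunctor C C')
    (T : Trans C C') : Prop := {
  gd_tr1 : gd C' ∘ tr1 T = F0 F;
  gc_tr1 : gc C' ∘ tr1 T = F0 G;
  tr2_type : tr2 T ∈
    mul C' ∘ ⟨F1 G, tr1 T ∘ gd C⟩ ⇒ mul C' ∘ ⟨tr1 T ∘ gc C, F1 F⟩;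
  tr2_inv : invertible (tr2 T);
  gd_tr2 : gd C' ◃ tr2 T = 𝟙 (gd C' ∘ F1 F);
  gc_tr2 : gc C' ◃ tr2 T = 𝟙 (gc C' ∘ F1 G);
  tr2_mul :
    let t := tr1 T in let τ := tr2 T in
    let π1 := p21 C in let π2 := p22 C in
    (assoc C' ▹ ⟨t ∘ gc C ∘ π1, F1 F ∘ π1, F1 F ∘ π2⟩)
      · (mul C' ◃ ⟪𝟙 (t ∘ gc C ∘ π1), mu F⟫)
      · (τ ▹ mul C)
      · (mul C' ◃ ⟪(mu G)⁻¹, 𝟙 (t ∘ gd C ∘ π2)⟫)
    = (mul C' ◃ ⟪τ ▹ π1, 𝟙 (F1 F ∘ π2)⟫)
      · (assoc C' ▹ ⟨F1 G ∘ π1, t ∘ gc C ∘ π2, F1 F ∘ π2⟩)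
      · (mul C' ◃ ⟪𝟙 (F1 G ∘ π1), τ ▹ π2⟫)
      · ((assoc C')⁻¹ ▹ ⟨F1 G ∘ π1, F1 G ∘ π2, t ∘ gd C ∘ π2⟩);
  tr2_unit :
    let t := tr1 T in let τ := tr2 T in
    (lun C' ▹ t) · (mul C' ◃ ⟪eps G, 𝟙 t⟫)
    = (run C' ▹ t) · (mul C' ◃ ⟪𝟙 t, eps F⟫) · (τ ▹ ge C)
}.

Record PseudoNat (K : TwoCat) (C C' : PseudoCat K) (F G : PseudoFunctor C C') := {
  trans :> Trans C C';
  transP : is_pseudo_nat F G trans
}.

Definition otimes (K : TwoCat) (C C' : PseudoCat K) (F G H : PseudoFunctor C C')
    (S : PseudoNat G H) (T : PseudoNat F G) : Trans C C' :=
  let t := tr1 T in let τ := tr2 T in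
  let s := tr1 S in let σ := tr2 S in
  MkTrans
    (mul C' ∘ ⟨s, t⟩)
    ((assoc C' ▹ ⟨s ∘ gc C, t ∘ gc C, F1 F⟩)
       · (mul C' ◃ ⟪𝟙 (s ∘ gc C), τ⟫)
       · ((assoc C')⁻¹ ▹ ⟨s ∘ gc C, F1 G, t ∘ gd C⟩)
       · (mul C' ◃ ⟪σ, 𝟙 (t ∘ gd C)⟫)
       · (assoc C' ▹ ⟨F1 H, s ∘ gd C, t ∘ gd C⟩)).
Notation "S ⊗ T" := (otimes S T) (at level 40, left associativity) : cell_scope.

(* Main.v *)
Require Import Defs.
From Stdlib Require Import ssreflect Classical_Prop ClassicalEpsilon.

(** Fix an object [X].  The 1-cells [X -> C0'], the 1-cells [f : X -> C1'] seen
as arrows between [c f] and [d f], and the 2-cells between such [f] that [d]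
and [c] send to identities, form a bicategory ([local_bicat]): its tensor is
[m' ∘ ⟨f, g⟩], its constraints are the restrictions of [α'], [λ'], [ρ'], and
its axioms are the axioms of [C'] restricted along the induced 1-cell into the
relevant pullback.  All the 2-cells in the definition of pseudo-functors and
pseudo-natural transformations are of this globular kind, so [F], [G], [H] and
[T], [S] become, on generalized elements at [X], the data of ordinary pseudo-
functors and transformations with values in a bicategory: [F1 ∘ f], the cells
[μ ▹ ⟨f, g⟩] and [ε ▹ x], the components [t ∘ x] and the squares [τ ▹ f].

On generalized elements the 2-cell of [S ⊗ T] is the vertical pasting of the
square of [S] over the square of [T] ([otimes_wr]), so the theorem becomes the
classical fact that pseudo-natural transformations between bicategories compose.
The compatibility with multiplication says that the square at a composite is,
up to [μ], the horizontal pasting of two squares; it is inherited by the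
composite because horizontal and vertical pasting satisfy an interchange law
([hpaste_vpaste], [vpaste_mul]), which is where the pentagon is used.  The
compatibility with units ([vpaste_unit]) follows from the two identities of
Kelly, which compute the unit constraints of a tensor product from the pentagon
and the triangle ([bl_bm], [br_bm]).

The two axioms of [S ⊗ T] are instances of these laws for universal generalized
elements: the two projections at [X = C2] for the multiplication, and the
identity of [C0] at [X = C0] for the units.  The typing and the invertibility
of [σ⊗τ] are read off from the pasting at the identity of [C1]. *)

Set Implicit Arguments.
Unset Strict Implicit.
Unset Printing Implicit Defensive.

Local Open Scope cell_scope.

Declare Scope bicat_scope.
Delimit Scope bicat_scope with bicat.

(** * Bicategories *)

(** The arrow [bm f g] is written in the order of [m' ∘ ⟨f, g⟩], and [asc]
points in the direction of [α'].  The 2-cells are indexed by their source and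
target, so that vertical composition is total and equations of 2-cells can be
rewritten without side conditions. *)
Record Bicat := {
  bob : Type;
  bhom : bob -> bob -> Type;
  bcell : forall x y, bhom x y -> bhom x y -> Type;
  bid : forall x y (f : bhom x y), bcell f f;
  bv : forall x y (f g h : bhom x y), bcell g h -> bcell f g -> bcell f h;
  bm : forall x y z, bhom x y -> bhom y z -> bhom x z;
  bh : forall x y z (f f' : bhom x y) (g g' : bhom y z),
    bcell f f' -> bcell g g' -> bcell (bm f g) (bm f' g');
  bu : forall x, bhom x x;
  asc : forall x y z w (f : bhom x y) (g : bhom y z) (h : bhom z w),
    bcell (bm f (bm g h)) (bm (bm f g) h);
  asci : forall x y z w (f : bhom x y) (g : bhom y z) (h : bhom z w),
    bcell (bm (bm f g) h) (bm f (bm g h));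
  bl : forall x y (f : bhom x y), bcell (bm (bu x) f) f;
  bli : forall x y (f : bhom x y), bcell f (bm (bu x) f);
  br : forall x y (f : bhom x y), bcell (bm f (bu y)) f;
  bri : forall x y (f : bhom x y), bcell f (bm f (bu y));
  bvA : forall x y (f g h k : bhom x y) (c : bcell h k) (b : bcell g h)
    (a : bcell f g), bv (bv c b) a = bv c (bv b a);
  bv1l : forall x y (f g : bhom x y) (a : bcell f g), bv (bid g) a = a;
  bv1r : forall x y (f g : bhom x y) (a : bcell f g), bv a (bid f) = a;
  bh1 : forall x y z (f : bhom x y) (g : bhom y z),
    bh (bid f) (bid g) = bid (bm f g);
  bhv : forall x y z (f f' f'' : bhom x y) (g g' g'' : bhom y z)
    (a' : bcell f' f'') (a : bcell f f') (b' : bcell g' g'') (b : bcell g g'),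
    bh (bv a' a) (bv b' b) = bv (bh a' b') (bh a b);
  ascK : forall x y z w (f : bhom x y) (g : bhom y z) (h : bhom z w),
    bv (asci f g h) (asc f g h) = bid _;
  asciK : forall x y z w (f : bhom x y) (g : bhom y z) (h : bhom z w),
    bv (asc f g h) (asci f g h) = bid _;
  asc_nat : forall x y z w (f f' : bhom x y) (g g' : bhom y z) (h h' : bhom z w)
    (a : bcell f f') (b : bcell g g') (c : bcell h h'),
    bv (asc f' g' h') (bh a (bh b c)) = bv (bh (bh a b) c) (asc f g h);
  blK : forall x y (f : bhom x y), bv (bli f) (bl f) = bid _;
  brK : forall x y (f : bhom x y), bv (bri f) (br f) = bid _;
  bliK : forall x y (f : bhom x y), bv (bl f) (bli f) = bid _;
  briK : forall x y (f : bhom x y), bv (br f) (bri f) = bid _;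
  bl_nat : forall x y (f f' : bhom x y) (a : bcell f f'),
    bv (bl f') (bh (bid (bu x)) a) = bv a (bl f);
  br_nat : forall x y (f f' : bhom x y) (a : bcell f f'),
    bv (br f') (bh a (bid (bu y))) = bv a (br f);
  bpent : forall x y z w v (k : bhom x y) (f : bhom y z) (g : bhom z w) (h : bhom w v),
    bv (asc (bm k f) g h) (asc k f (bm g h))
    = bv (bh (asc k f g) (bid h)) (bv (asc k (bm f g) h) (bh (bid k) (asc f g h)));
  btri : forall x y z (f : bhom x y) (g : bhom y z),
    bv (bh (br f) (bid g)) (asc f (bu y) g) = bh (bid f) (bl g)
}.

Notation "f ⊙ g" := (bm f g) (at level 40, left associativity) : bicat_scope.
Notation "b • a" := (bv b a) (at level 44, right associativity) : bicat_scope.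
Notation "f ◁ a" := (bh (bid f) a) (at level 40, left associativity) : bicat_scope.
Notation "a ▷ f" := (bh a (bid f)) (at level 40, left associativity) : bicat_scope.

Section Bicategory.
Local Open Scope bicat_scope.
Variable B : Bicat.

Lemma bwl_bv x y z (f : bhom x y) (g g' g'' : bhom y z) (b : bcell g' g'')
  (a : @bcell B _ _ g g') : f ◁ (b • a) = (f ◁ b) • (f ◁ a).
Proof. by rewrite -bhv bv1l. Qed.

Lemma bwr_bv x y z (f : bhom y z) (g g' g'' : bhom x y) (b : bcell g' g'')
  (a : @bcell B _ _ g g') : (b • a) ▷ f = (b ▷ f) • (a ▷ f).
Proof. by rewrite -bhv bv1l. Qed.

(** [bv_step] and [bv_slide] apply an equation to the first two factors of a
right-associated composite. *)
Lemma bv_step x y (f g h k : @bhom B x y) (b : bcell g h) (a : bcell f g) (c : bcell f h)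
  (u : bcell k f) : b • a = c -> b • a • u = c • u.
Proof. by move=> <-; rewrite bvA. Qed.

Lemma bv_slide x y (f g g' h k : @bhom B x y) (b : bcell g h) (a : bcell f g)
  (b' : bcell g' h) (a' : bcell f g') (u : bcell k f) :
  b • a = b' • a' -> b • a • u = b' • a' • u.
Proof. by move=> E; rewrite -!bvA E. Qed.

Lemma bwl_bwr x y z (f f' : @bhom B x y) (g g' : bhom y z) (a : bcell f f') (b : bcell g g') :
  (a ▷ g') • (f ◁ b) = (f' ◁ b) • (a ▷ g).
Proof. by rewrite -!bhv !bv1l !bv1r. Qed.

Section Assoc.
Variables (x y z w : bob B).
Implicit Types (f : bhom x y) (g : bhom y z) (h : bhom z w).

Lemma asci_nat f f' g g' h h' (a : bcell f f') (b : bcell g g') (c : bcell h h') :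
  asci f' g' h' • bh (bh a b) c = bh a (bh b c) • asci f g h.
Proof.
by rewrite -[LHS]bv1r -(asciK f g h) !bvA -(bvA _ (asc f g h)) -asc_nat bvA -bvA ascK bv1l.
Qed.

Lemma asc_natl f f' g h (a : bcell f f') :
  asc f' g h • (a ▷ (g ⊙ h)) = (a ▷ g ▷ h) • asc f g h.
Proof. by rewrite -bh1 asc_nat. Qed.
Lemma asc_natm f g g' h (a : bcell g g') :
  asc f g' h • (f ◁ (a ▷ h)) = (f ◁ a ▷ h) • asc f g h.
Proof. exact: asc_nat. Qed.
Lemma asc_natr f g h h' (a : bcell h h') :
  asc f g h' • (f ◁ (g ◁ a)) = ((f ⊙ g) ◁ a) • asc f g h.
Proof. by rewrite asc_nat bh1. Qed.
Lemma asci_natl f f' g h (a : bcell f f') :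
  asci f' g h • (a ▷ g ▷ h) = (a ▷ (g ⊙ h)) • asci f g h.
Proof. by rewrite asci_nat bh1. Qed.
Lemma asci_natm f g g' h (a : bcell g g') :
  asci f g' h • (f ◁ a ▷ h) = (f ◁ (a ▷ h)) • asci f g h.
Proof. exact: asci_nat. Qed.
Lemma asci_natr f g h h' (a : bcell h h') :
  asci f g h' • ((f ⊙ g) ◁ a) = (f ◁ (g ◁ a)) • asci f g h.
Proof. by rewrite -asci_nat bh1. Qed.

Lemma asc_epi f g h k (a b : bcell _ k) : a • asc f g h = b • asc f g h -> a = b.
Proof. by move=> E; rewrite -[a]bv1r -[b]bv1r -(asciK f g h) -!bvA E. Qed.
Lemma asc_mono f g h k (a b : bcell k _) : asc f g h • a = asc f g h • b -> a = b.
Proof. by move=> E; rewrite -[a]bv1l -[b]bv1l -(ascK f g h) !bvA E. Qed.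
End Assoc.

(** The pentagon, solved for the mixtures of [asc] and [asci] that
[hpaste_vpaste] has to rebracket. *)
Lemma bpent_inv x y z w v (k : bhom x y) (f : bhom y z) (g : bhom z w) (h : @bhom B w v) :
  asci k f (g ⊙ h) • asci (k ⊙ f) g h
  = (k ◁ asci f g h) • asci k (f ⊙ g) h • (asci k f g ▷ h).
Proof.
apply: (@asc_mono _ _ _ _ k f (g ⊙ h)); apply: (@asc_mono _ _ _ _ (k ⊙ f) g h).
rewrite (bv_step _ (asciK _ _ _)) bv1l asciK -[RHS]bvA bpent !bvA.
rewrite (bv_step _ (eq_sym (bwl_bv _ _ _))) asciK bh1 bv1l (bv_step _ (asciK _ _ _)) bv1l.
by rewrite -bwr_bv asciK bh1.
Qed.

Lemma bpent_move x y z w v (k : bhom x y) (f : bhom y z) (g : bhom z w) (h : @bhom B w v) :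
  asci k (f ⊙ g) h • (asci k f g ▷ h) • asc (k ⊙ f) g h
  = (k ◁ asc f g h) • asci k f (g ⊙ h).
Proof.
apply: (@asc_epi _ _ _ _ k f (g ⊙ h)); rewrite !bvA bpent ascK bv1r.
by rewrite (bv_step _ (eq_sym (bwr_bv _ _ _))) ascK bh1 bv1l (bv_step _ (ascK _ _ _)) bv1l.
Qed.

Lemma bpent_movel x y z w v (k : bhom x y) (f : bhom y z) (g : bhom z w) (h : @bhom B w v) :
  asc k (f ⊙ g) h • (k ◁ asc f g h) • asci k f (g ⊙ h)
  = (asci k f g ▷ h) • asc (k ⊙ f) g h.
Proof. by rewrite -bpent_move (bv_step _ (asciK _ _ _)) bv1l. Qed.

Lemma bpent_mover x y z w v (k : bhom x y) (f : bhom y z) (g : bhom z w) (h : @bhom B w v) :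
  asci (k ⊙ f) g h • (asc k f g ▷ h)
  = asc k f (g ⊙ h) • (k ◁ asci f g h) • asci k (f ⊙ g) h.
Proof.
apply: (@asc_mono _ _ _ _ (k ⊙ f) g h).
rewrite (bv_step _ (asciK _ _ _)) bv1l (bv_step _ (bpent _ _ _ _)) !bvA.
by rewrite (bv_step _ (eq_sym (bwl_bv _ _ _))) asciK bh1 bv1l asciK bv1r.
Qed.

(** Tensoring with a unit is isomorphic to the identity functor, hence faithful. *)
Lemma bu_wl_inj x y (f g : @bhom B x y) (a b : bcell f g) :
  bu x ◁ a = bu x ◁ b -> a = b.
Proof.
move=> E; rewrite -[a]bv1r -[b]bv1r -(bliK f) -!bvA -!bl_nat.
by rewrite E.
Qed.

Lemma bu_wr_inj x y (f g : @bhom B x y) (a b : bcell f g) :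
  a ▷ bu y = b ▷ bu y -> a = b.
Proof.
move=> E; rewrite -[a]bv1r -[b]bv1r -(briK f) -!bvA -!br_nat.
by rewrite E.
Qed.

(** Kelly's argument: after tensoring with [bu x] on the left, the two sides
differ by the pentagon for [bu x], [bu x], [f], [g], two triangles and two
naturality squares. *)
Lemma bl_bm x y z (f : bhom x y) (g : @bhom B y z) :
  bl (f ⊙ g) = (bl f ▷ g) • asc (bu x) f g.
Proof.
apply: bu_wl_inj; apply: (@asc_mono _ _ _ _ (bu x) f g).
rewrite bwl_bv -btri -bvA asc_natl bvA bpent -bvA -bwr_bv btri -!bvA asc_natm.
by rewrite bvA.
Qed.

(** The mirror image of [bl_bm], from the pentagon for [f], [g], [bu z], [bu z]. *)
Lemma br_bm x y z (f : bhom x y) (g : @bhom B y z) :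
  br (f ⊙ g) • asc f g (bu z) = f ◁ br g.
Proof.
apply: bu_wr_inj; apply: (@asc_epi _ _ _ _ f (g ⊙ bu z) (bu z)).
have /(f_equal (fun a => (br (f ⊙ g) ▷ bu z) • a • (f ◁ asci g (bu z) (bu z)))) :=
  bpent f g (bu z) (bu z).
rewrite -!bvA btri -asc_natr -btri bwl_bv -bvA asc_natm !bvA -bwl_bv asciK bh1 !bv1r.
by rewrite -bvA -bwr_bv => <-.
Qed.

(** The formula of [σ⊗τ], for squares with arbitrary sides. *)
Definition vpaste x y x' y' x'' y'' (h : bhom x y) (g : bhom x' y') (f : @bhom B x'' y'')
    (s : bhom x x') (s' : bhom y y') (t : bhom x' x'') (t' : bhom y' y'')
    (σ : bcell (h ⊙ s') (s ⊙ g)) (τ : bcell (g ⊙ t') (t ⊙ f)) :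
    bcell (h ⊙ (s' ⊙ t')) ((s ⊙ t) ⊙ f) :=
  asc s t f • (s ◁ τ) • asci s g t' • (σ ▷ t') • asc h s' t'.

(** The bracketing of the source and the target is the one of the multiplication
axiom of a pseudo-natural transformation. *)
Definition hpaste x y z x' y' z' (g1 : bhom x y) (g2 : bhom y z)
    (f1 : bhom x' y') (f2 : @bhom B y' z')
    (t1 : bhom x x') (t2 : bhom y y') (t3 : bhom z z')
    (τ1 : bcell (g1 ⊙ t2) (t1 ⊙ f1)) (τ2 : bcell (g2 ⊙ t3) (t2 ⊙ f2)) :
    bcell ((g1 ⊙ g2) ⊙ t3) ((t1 ⊙ f1) ⊙ f2) :=
  (τ1 ▷ f2) • asc g1 t2 f2 • (g1 ◁ τ2) • asci g1 g2 t3.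

(** Interchange of the two pastings of a 2 by 2 grid of squares, up to
associativity.  One side composes the squares in the order [σ2], [τ2], [σ1],
[τ1], the other in the order [σ2], [σ1], [τ2], [τ1]; so the proof is the
interchange of [σ1] and [τ2], surrounded by pentagons and naturality squares
that rebracket. *)
Lemma hpaste_vpaste x y z x' y' z' x'' y'' z''
    (h1 : bhom x y) (h2 : bhom y z) (g1 : bhom x' y') (g2 : bhom y' z')
    (f1 : bhom x'' y'') (f2 : @bhom B y'' z'')
    (s1 : bhom x x') (s2 : bhom y y') (s3 : bhom z z')
    (t1 : bhom x' x'') (t2 : bhom y' y'') (t3 : bhom z' z'')
    (σ1 : bcell (h1 ⊙ s2) (s1 ⊙ g1)) (σ2 : bcell (h2 ⊙ s3) (s2 ⊙ g2))
    (τ1 : bcell (g1 ⊙ t2) (t1 ⊙ f1)) (τ2 : bcell (g2 ⊙ t3) (t2 ⊙ f2)) :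
  hpaste (vpaste σ1 τ1) (vpaste σ2 τ2)
  = (asc s1 t1 f1 ▷ f2) • asc s1 (t1 ⊙ f1) f2 • (s1 ◁ hpaste τ1 τ2)
    • asci s1 (g1 ⊙ g2) t3 • ((asci s1 g1 g2 • hpaste σ1 σ2) ▷ t3)
    • asc (h1 ⊙ h2) s3 t3.
Proof.
rewrite /hpaste /vpaste !bwr_bv !bwl_bv !bvA (bv_step _ (asc_natm _ _ _)) bvA.
congr (_ • _); congr (_ • _); apply: eq_sym.
have -> u : (s1 ◁ asci g1 g2 t3) • asci s1 (g1 ⊙ g2) t3 • (asci s1 g1 g2 ▷ t3) • u
    = asci s1 g1 (g2 ⊙ t3) • asci (s1 ⊙ g1) g2 t3 • u.
  by rewrite -[RHS]bvA bpent_inv !bvA.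
rewrite -(bv_slide _ (asci_natr _ _ _)).
have -> u : asc s1 (g1 ⊙ t2) f2 • (s1 ◁ asc g1 t2 f2) • asci s1 g1 (t2 ⊙ f2) • u
    = (asci s1 g1 t2 ▷ f2) • asc (s1 ⊙ g1) t2 f2 • u.
  by rewrite -[RHS]bvA -bpent_movel !bvA.
congr (_ • _).
(* the whiskered [σ1] moves to the left, past [τ2] *)
rewrite (bv_step _ (asci_natl _ _ _)) bvA -(bv_slide _ (bwl_bwr _ _)).
rewrite (bv_step _ (asc_natl _ _ _)) bvA; congr (_ • _).
rewrite (bv_step _ (bpent_mover _ _ _ _)) !bvA -(bv_slide _ (asc_natr _ _ _)).
rewrite (bv_step _ (bpent _ _ _ _)) !bvA; do 5! congr (_ • _).
by rewrite (bv_step _ (asci_natm _ _ _)) bvA bpent_move.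
Qed.

(** Compatibility with multiplication composes: the inner comparison [μg] of
the middle functor cancels against its inverse, and what remains is
[hpaste_vpaste]. *)
Lemma vpaste_mul x y z x' y' z' x'' y'' z''
    (h1 : bhom x y) (h2 : bhom y z) (g1 : bhom x' y') (g2 : bhom y' z')
    (f1 : bhom x'' y'') (f2 : @bhom B y'' z'') h12 g12 f12
    (μhi : bcell (h1 ⊙ h2) h12)
    (μg : bcell g12 (g1 ⊙ g2)) (μgi : bcell (g1 ⊙ g2) g12)
    (μf : bcell f12 (f1 ⊙ f2))
    (s1 : bhom x x') (s2 : bhom y y') (s3 : bhom z z')
    (t1 : bhom x' x'') (t2 : bhom y' y'') (t3 : bhom z' z'')
    (σ1 : bcell (h1 ⊙ s2) (s1 ⊙ g1)) (σ2 : bcell (h2 ⊙ s3) (s2 ⊙ g2))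
    (σ12 : bcell (h12 ⊙ s3) (s1 ⊙ g12))
    (τ1 : bcell (g1 ⊙ t2) (t1 ⊙ f1)) (τ2 : bcell (g2 ⊙ t3) (t2 ⊙ f2))
    (τ12 : bcell (g12 ⊙ t3) (t1 ⊙ f12)) :
  μgi • μg = bid _ ->
  asc s1 g1 g2 • (s1 ◁ μg) • σ12 • (μhi ▷ s3) = hpaste σ1 σ2 ->
  asc t1 f1 f2 • (t1 ◁ μf) • τ12 • (μgi ▷ t3) = hpaste τ1 τ2 ->
  asc (s1 ⊙ t1) f1 f2 • ((s1 ⊙ t1) ◁ μf) • vpaste σ12 τ12 • (μhi ▷ (s3 ⊙ t3))
  = hpaste (vpaste σ1 τ1) (vpaste σ2 τ2).
Proof.
move=> μgK σM τM; rewrite hpaste_vpaste -σM -τM /vpaste !bwl_bv.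
rewrite (bv_step _ (ascK _ _ _)) bv1l !bwr_bv !bvA.
rewrite asc_natl -(bv_slide _ (asc_natr _ _ _)).
rewrite (bv_step _ (bpent _ _ _ _)) !bvA; do 5! congr (_ • _).
rewrite -(bv_slide _ (asci_natm _ _ _)); congr (_ • _).
by rewrite -[RHS]bvA -bwr_bv -bwl_bv μgK !bh1 bv1l.
Qed.

(** The comparison [εg] of the middle functor is carried from the unit law of
[τ] to the unit law of [σ] through the triangle for [s] and [t]. *)
Lemma vpaste_unit x x' x'' (h : bhom x x) (g : bhom x' x') (f : @bhom B x'' x'')
    (εh : bcell h (bu x)) (εg : bcell g (bu x')) (εf : bcell f (bu x''))
    (s : bhom x x') (t : bhom x' x'')
    (σ : bcell (h ⊙ s) (s ⊙ g)) (τ : bcell (g ⊙ t) (t ⊙ f)) :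
  bl s • (εh ▷ s) = br s • (s ◁ εg) • σ ->
  bl t • (εg ▷ t) = br t • (t ◁ εf) • τ ->
  bl (s ⊙ t) • (εh ▷ (s ⊙ t)) = br (s ⊙ t) • ((s ⊙ t) ◁ εf) • vpaste σ τ.
Proof.
move=> σ1 τ1; rewrite bl_bm bvA asc_natl -bvA -bwr_bv σ1 /vpaste.
rewrite -(bv_slide _ (asc_natr _ _ _)) (bv_step _ (br_bm _ _)) !bwr_bv !bvA.
have -> u : (s ◁ br t) • (s ◁ (t ◁ εf)) • (s ◁ τ) • u
    = (s ◁ bl t) • (s ◁ (εg ▷ t)) • u.
  by rewrite -!bvA -!bwl_bv !bvA -τ1.
rewrite -(bv_slide _ (asci_natm _ _ _)) -btri bvA.
by rewrite (bv_step _ (asciK _ _ _)) bv1l.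
Qed.

Definition biso x y (f g : @bhom B x y) (a : bcell f g) :=
  exists b, b • a = bid f /\ a • b = bid g.

Lemma biso_bv x y (f g h : @bhom B x y) (b : bcell g h) (a : bcell f g) :
  biso b -> biso a -> biso (b • a).
Proof.
move=> [b' [K1 K2]] [a' [L1 L2]]; exists (a' • b'); split.
  by rewrite bvA (bv_step _ K1) bv1l.
by rewrite bvA (bv_step _ L2) bv1l.
Qed.

Lemma biso_bh x y z (f f' : bhom x y) (g g' : @bhom B y z) (a : bcell f f') (b : bcell g g') :
  biso a -> biso b -> biso (bh a b).
Proof.
move=> [a' [K1 K2]] [b' [L1 L2]]; exists (bh a' b').
by rewrite -!bhv K1 K2 L1 L2 !bh1.
Qed.

Lemma biso_bid x y (f : @bhom B x y) : biso (bid f).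
Proof. by exists (bid f); rewrite bv1l. Qed.

Lemma biso_vpaste x y x' y' x'' y'' (h : bhom x y) (g : bhom x' y') (f : @bhom B x'' y'')
    (s : bhom x x') (s' : bhom y y') (t : bhom x' x'') (t' : bhom y' y'')
    (σ : bcell (h ⊙ s') (s ⊙ g)) (τ : bcell (g ⊙ t') (t ⊙ f)) :
  biso σ -> biso τ -> biso (vpaste σ τ).
Proof.
move=> σI τI; have aI x1 y1 z1 w1 (k : bhom x1 y1) (l : bhom y1 z1) (m : @bhom B z1 w1) :
    biso (asc k l m).
  by exists (asci k l m); rewrite ascK asciK.
have aiI x1 y1 z1 w1 (k : bhom x1 y1) (l : bhom y1 z1) (m : @bhom B z1 w1) :
    biso (asci k l m).
  by exists (asc k l m); rewrite ascK asciK.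
do 4![apply: biso_bv => //; try exact/biso_bh/biso_bid; try exact: biso_bh (biso_bid _) _].
Qed.
End Bicategory.

(** * Calculus of 2-cells and induced cells *)

Lemma epsilon_unique (A : Type) (i : inhabited A) (P : A -> Prop) :
  (exists! u, P u) -> P (epsilon i P).
Proof. by case=> u [Pu _]; apply: (epsilon_spec i P); exists u. Qed.

Section Cells.
Variable K : TwoCat.

Lemma wl_vcomp (A B C : ob K) (g : hom B C) (b a : cell A B) :
  tgt a = src b -> g ◃ (b · a) = (g ◃ b) · (g ◃ a).
Proof.
by move=> E; rewrite -{1}(vcompc1 (𝟙 g)) src_idc interchange ?src_idc ?tgt_idc.
Qed.

Lemma wr_vcomp (A B C : ob K) (f : hom A B) (b a : cell B C) :
  tgt a = src b -> (b · a) ▹ f = (b ▹ f) · (a ▹ f).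
Proof.
by move=> E; rewrite -{1}(vcompc1 (𝟙 f)) src_idc interchange ?src_idc ?tgt_idc.
Qed.

Lemma wl_comp (A B C D : ob K) (h : hom C D) (g : hom B C) (a : cell A B) :
  h ◃ (g ◃ a) = (h ∘ g) ◃ a.
Proof. by rewrite hcompA hcomp_idc. Qed.

Lemma wr_comp (A B C D : ob K) (g : hom B C) (f : hom A B) (a : cell C D) :
  a ▹ g ▹ f = a ▹ (g ∘ f).
Proof. by rewrite -hcompA hcomp_idc. Qed.

Lemma hcomp_srctgt (A B C : ob K) (b : cell B C) (a : cell A B) :
  hcomp b a = (b ▹ tgt a) · (src b ◃ a).
Proof. by rewrite -interchange ?src_idc ?tgt_idc // vcomp1c vcompc1. Qed.

Lemma hcomp_tgtsrc (A B C : ob K) (b : cell B C) (a : cell A B) :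
  hcomp b a = (tgt b ◃ a) · (b ▹ src a).
Proof. by rewrite -interchange ?src_idc ?tgt_idc // vcomp1c vcompc1. Qed.

Lemma vinvP (A B : ob K) (a : cell A B) : invertible a -> is_inverse a (a⁻¹).
Proof. exact: epsilon_spec. Qed.

(** Since [g ◃ a⁻¹] is inverse to the identity [g ◃ a]. *)
Lemma vinv_wl (A B C : ob K) (g : hom B C) (h : hom A C) (a : cell A B) :
  invertible a -> g ◃ a = 𝟙 h -> g ◃ a⁻¹ = 𝟙 h.
Proof.
move=> /vinvP [[s t] [ia ai]] E.
have Et : g ∘ tgt a = h by rewrite -[g]tgt_idc -tgt_hcomp E tgt_idc.
have Es : g ∘ src a = h by rewrite -[g]src_idc -src_hcomp E src_idc.
have : (g ◃ a⁻¹) · (g ◃ a) = 𝟙 h by rewrite -wl_vcomp ?s // ia hcomp_idc Es.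
rewrite E; have {1}<- : src (g ◃ a⁻¹) = h by rewrite src_hcomp src_idc s.
by rewrite vcompc1.
Qed.

Section Pairing.
Variables (G : IGraph K) (X : ob K).

Lemma pair2P (f g : hom X (C1 G)) : gd G ∘ f = gc G ∘ g ->
  p21 G ∘ ⟨f, g⟩ = f /\ p22 G ∘ ⟨f, g⟩ = g.
Proof. by move=> E; exact: epsilon_unique (pb2_hom (C2P G) E). Qed.

Lemma pair2_eta (u : hom X (C2 G)) : ⟨p21 G ∘ u, p22 G ∘ u⟩ = u.
Proof.
have E : gd G ∘ (p21 G ∘ u) = gc G ∘ (p22 G ∘ u) by rewrite !compA (pb2_comm (C2P G)).
case: (pb2_hom (C2P G) E) => v [_ vU].
by rewrite -(vU _ (pair2P E)) -(vU u).
Qed.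

Lemma pair3P (f g h : hom X (C1 G)) : gd G ∘ f = gc G ∘ g -> gd G ∘ g = gc G ∘ h ->
  p31 G ∘ ⟨f, g, h⟩ = f /\ p32 G ∘ ⟨f, g, h⟩ = g /\ p33 G ∘ ⟨f, g, h⟩ = h.
Proof. by move=> E E'; exact: epsilon_unique (pb3_hom (C3P G) E E'). Qed.

Lemma pair3_eta (u : hom X (C3 G)) : ⟨p31 G ∘ u, p32 G ∘ u, p33 G ∘ u⟩ = u.
Proof.
have [E1 E2] := pb3_comm (C3P G).
have E : gd G ∘ (p31 G ∘ u) = gc G ∘ (p32 G ∘ u) by rewrite !compA E1.
have E' : gd G ∘ (p32 G ∘ u) = gc G ∘ (p33 G ∘ u) by rewrite !compA E2.
case: (pb3_hom (C3P G) E E') => v [_ vU].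
by rewrite -(vU _ (pair3P E E')) -(vU u).
Qed.

Lemma pair4P (f g h k : hom X (C1 G)) :
  gd G ∘ f = gc G ∘ g -> gd G ∘ g = gc G ∘ h -> gd G ∘ h = gc G ∘ k ->
  p41 G ∘ ⟨f, g, h, k⟩ = f /\ p42 G ∘ ⟨f, g, h, k⟩ = g
  /\ p43 G ∘ ⟨f, g, h, k⟩ = h /\ p44 G ∘ ⟨f, g, h, k⟩ = k.
Proof. by move=> E E' E''; exact: epsilon_unique (pb4_hom (C4P G) E E' E''). Qed.

Lemma cpair2P (a b : cell X (C1 G)) : gd G ◃ a = gc G ◃ b ->
  p21 G ◃ ⟪a, b⟫ = a /\ p22 G ◃ ⟪a, b⟫ = b.
Proof. by move=> E; exact: epsilon_unique (pb2_cell (C2P G) E). Qed.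

Lemma cpair2_eta (u : cell X (C2 G)) : ⟪p21 G ◃ u, p22 G ◃ u⟫ = u.
Proof.
have E : gd G ◃ (p21 G ◃ u) = gc G ◃ (p22 G ◃ u).
  by rewrite !wl_comp (pb2_comm (C2P G)).
case: (pb2_cell (C2P G) E) => v [_ vU].
by rewrite -(vU _ (cpair2P E)) -(vU u).
Qed.

Lemma cpair3P (a b c : cell X (C1 G)) : gd G ◃ a = gc G ◃ b -> gd G ◃ b = gc G ◃ c ->
  p31 G ◃ ⟪a, b, c⟫ = a /\ p32 G ◃ ⟪a, b, c⟫ = b /\ p33 G ◃ ⟪a, b, c⟫ = c.
Proof. by move=> E E'; exact: epsilon_unique (pb3_cell (C3P G) E E'). Qed.

Lemma src_cpair2 (a b : cell X (C1 G)) : gd G ◃ a = gc G ◃ b ->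
  src ⟪a, b⟫ = ⟨src a, src b⟩.
Proof.
move=> E; have [E1 E2] := cpair2P E.
have -> : src a = p21 G ∘ src ⟪a, b⟫ by rewrite -{1}E1 src_hcomp src_idc.
have -> : src b = p22 G ∘ src ⟪a, b⟫ by rewrite -{1}E2 src_hcomp src_idc.
by rewrite pair2_eta.
Qed.

Lemma tgt_cpair2 (a b : cell X (C1 G)) : gd G ◃ a = gc G ◃ b ->
  tgt ⟪a, b⟫ = ⟨tgt a, tgt b⟩.
Proof.
move=> E; have [E1 E2] := cpair2P E.
have -> : tgt a = p21 G ∘ tgt ⟪a, b⟫ by rewrite -{1}E1 tgt_hcomp tgt_idc.
have -> : tgt b = p22 G ∘ tgt ⟪a, b⟫ by rewrite -{1}E2 tgt_hcomp tgt_idc.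
by rewrite pair2_eta.
Qed.

Lemma src_cpair3 (a b c : cell X (C1 G)) : gd G ◃ a = gc G ◃ b -> gd G ◃ b = gc G ◃ c ->
  src ⟪a, b, c⟫ = ⟨src a, src b, src c⟩.
Proof.
move=> E E'; have [E1 [E2 E3]] := cpair3P E E'.
have -> : src a = p31 G ∘ src ⟪a, b, c⟫ by rewrite -{1}E1 src_hcomp src_idc.
have -> : src b = p32 G ∘ src ⟪a, b, c⟫ by rewrite -{1}E2 src_hcomp src_idc.
have -> : src c = p33 G ∘ src ⟪a, b, c⟫ by rewrite -{1}E3 src_hcomp src_idc.
by rewrite pair3_eta.
Qed.

Lemma tgt_cpair3 (a b c : cell X (C1 G)) : gd G ◃ a = gc G ◃ b -> gd G ◃ b = gc G ◃ c ->
  tgt ⟪a, b, c⟫ = ⟨tgt a, tgt b, tgt c⟩.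
Proof.
move=> E E'; have [E1 [E2 E3]] := cpair3P E E'.
have -> : tgt a = p31 G ∘ tgt ⟪a, b, c⟫ by rewrite -{1}E1 tgt_hcomp tgt_idc.
have -> : tgt b = p32 G ∘ tgt ⟪a, b, c⟫ by rewrite -{1}E2 tgt_hcomp tgt_idc.
have -> : tgt c = p33 G ∘ tgt ⟪a, b, c⟫ by rewrite -{1}E3 tgt_hcomp tgt_idc.
by rewrite pair3_eta.
Qed.

Lemma cpair2_idc (f g : hom X (C1 G)) : gd G ∘ f = gc G ∘ g ->
  ⟪𝟙 f, 𝟙 g⟫ = 𝟙 ⟨f, g⟩.
Proof.
move=> /pair2P [E1 E2].
by rewrite -[RHS]cpair2_eta !hcomp_idc E1 E2.
Qed.

Lemma cpair2_vcomp (a' a b' b : cell X (C1 G)) :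
  gd G ◃ a' = gc G ◃ b' -> gd G ◃ a = gc G ◃ b -> tgt a = src a' -> tgt b = src b' ->
  ⟪a' · a, b' · b⟫ = ⟪a', b'⟫ · ⟪a, b⟫.
Proof.
move=> E' E ta tb; rewrite -[RHS]cpair2_eta.
have T : tgt ⟪a, b⟫ = src ⟪a', b'⟫ by rewrite tgt_cpair2 // src_cpair2 // ta tb.
rewrite !wl_vcomp //.
by have [-> ->] := cpair2P E; have [-> ->] := cpair2P E'.
Qed.

End Pairing.

Section Precomposition.
Variables (G : IGraph K) (X Y : ob K) (p : hom Y X).

Lemma pair2_comp (f g : hom X (C1 G)) : gd G ∘ f = gc G ∘ g ->
  ⟨f, g⟩ ∘ p = ⟨f ∘ p, g ∘ p⟩.
Proof.
by move=> E; rewrite -[LHS]pair2_eta !compA; have [-> ->] := pair2P E.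
Qed.

Lemma pair3_comp (f g h : hom X (C1 G)) : gd G ∘ f = gc G ∘ g -> gd G ∘ g = gc G ∘ h ->
  ⟨f, g, h⟩ ∘ p = ⟨f ∘ p, g ∘ p, h ∘ p⟩.
Proof.
by move=> E E'; rewrite -[LHS]pair3_eta !compA; have [-> [-> ->]] := pair3P E E'.
Qed.

Lemma cpair2_wr (a b : cell X (C1 G)) : gd G ◃ a = gc G ◃ b ->
  ⟪a, b⟫ ▹ p = ⟪a ▹ p, b ▹ p⟫.
Proof.
by move=> E; rewrite -[LHS]cpair2_eta !hcompA; have [-> ->] := cpair2P E.
Qed.
End Precomposition.

Lemma cpair2_wl (G : IGraph K) (X Y : ob K) (f g : hom X (C1 G)) (a : cell Y X) :
  gd G ∘ f = gc G ∘ g -> ⟨f, g⟩ ◃ a = ⟪f ◃ a, g ◃ a⟫.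
Proof.
by move=> E; rewrite -[LHS]cpair2_eta !wl_comp; have [-> ->] := pair2P E.
Qed.

End Cells.

(** * The bicategory of generalized elements *)

Section GeneralizedElements.
Variables (K : TwoCat) (C : PseudoCat K) (X : ob K).
Local Notation d := (gd C).
Local Notation c := (gc C).
Local Notation e := (ge C).
Local Notation m := (mul C).
Local Notation α := (assoc C).

(** The endpoints are required only up to propositional equality, so that one
1-cell can be used between different expressions for the same object. *)
Definition ghom (x y : hom X (C0 C)) :=
  {f : hom X (C1 C) | c ∘ f = x /\ d ∘ f = y}.

Definition gcell x y (f g : ghom x y) :=
  {a : cell X (C1 C) | a ∈ proj1_sig f ⇒ proj1_sig g /\ c ◃ a = 𝟙 x /\ d ◃ a = 𝟙 y}.

Lemma gcell_eq x y (f g : ghom x y) (a b : gcell f g) :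
  proj1_sig a = proj1_sig b -> a = b.
Proof.
by case: a b => [a P] [b Q] /= E; subst b; rewrite (proof_irrelevance _ P Q).
Qed.

Lemma ghom_match x y z (f : ghom x y) (g : ghom y z) :
  d ∘ proj1_sig f = c ∘ proj1_sig g.
Proof. by rewrite (proj2 (proj2_sig f)) (proj1 (proj2_sig g)). Qed.

Lemma gcell_match x y z (f f' : ghom x y) (g g' : ghom y z) (a : gcell f f') (b : gcell g g') :
  d ◃ proj1_sig a = c ◃ proj1_sig b.
Proof. by rewrite (proj2 (proj2 (proj2_sig a))) (proj1 (proj2 (proj2_sig b))). Qed.

Lemma src_gcell x y (f g : ghom x y) (a : gcell f g) : src (proj1_sig a) = proj1_sig f.
Proof. by case: a => a [[]]. Qed.
Lemma tgt_gcell x y (f g : ghom x y) (a : gcell f g) : tgt (proj1_sig a) = proj1_sig g.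
Proof. by case: a => a [[]]. Qed.

Lemma gid_proof x y (f : ghom x y) :
  𝟙 (proj1_sig f) ∈ proj1_sig f ⇒ proj1_sig f
  /\ c ◃ 𝟙 (proj1_sig f) = 𝟙 x /\ d ◃ 𝟙 (proj1_sig f) = 𝟙 y.
Proof.
case: f => f [fc fd] /=; rewrite !hcomp_idc fc fd.
by split=> //; split; [exact: src_idc | exact: tgt_idc].
Qed.
Definition gid x y (f : ghom x y) : gcell f f := exist _ _ (gid_proof f).

Lemma gv_proof x y (f g h : ghom x y) (b : gcell g h) (a : gcell f g) :
  let u := proj1_sig b · proj1_sig a in
  u ∈ proj1_sig f ⇒ proj1_sig h /\ c ◃ u = 𝟙 x /\ d ◃ u = 𝟙 y.
Proof.
have T : tgt (proj1_sig a) = src (proj1_sig b) by rewrite tgt_gcell src_gcell.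
have I (z : ob K) (k : hom X z) : 𝟙 k · 𝟙 k = 𝟙 k by rewrite -{1}[k]tgt_idc vcomp1c.
move=> u; rewrite /u !wl_vcomp //.
case: (b) (a) T => [b' [[sb tb] [cb db]]] [a' [[sa ta] [ca da]]] /= T.
rewrite cb db ca da !I; split=> //; split.
  by rewrite src_vcomp.
by rewrite tgt_vcomp.
Qed.
Definition gv x y (f g h : ghom x y) (b : gcell g h) (a : gcell f g) : gcell f h :=
  exist _ _ (gv_proof b a).

Lemma gm_proof x y z (f : ghom x y) (g : ghom y z) :
  let u := m ∘ ⟨proj1_sig f, proj1_sig g⟩ in c ∘ u = x /\ d ∘ u = z.
Proof.
have [E1 E2] := pair2P (ghom_match f g).
rewrite /= !compA gd_mul gc_mul -!compA E1 E2.
exact: conj (proj1 (proj2_sig f)) (proj2 (proj2_sig g)).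
Qed.
Definition gm x y z (f : ghom x y) (g : ghom y z) : ghom x z := exist _ _ (gm_proof f g).

Lemma gh_proof x y z (f f' : ghom x y) (g g' : ghom y z) (a : gcell f f') (b : gcell g g') :
  let u := m ◃ ⟪proj1_sig a, proj1_sig b⟫ in
  u ∈ proj1_sig (gm f g) ⇒ proj1_sig (gm f' g') /\ c ◃ u = 𝟙 x /\ d ◃ u = 𝟙 z.
Proof.
have E := gcell_match a b; have [E1 E2] := cpair2P E.
split.
  split; rewrite ?src_hcomp ?tgt_hcomp ?src_idc ?tgt_idc ?src_cpair2 ?tgt_cpair2 //.
    by rewrite !src_gcell.
  by rewrite !tgt_gcell.
rewrite /= !wl_comp gd_mul gc_mul -!wl_comp E1 E2.
exact: conj (proj1 (proj2 (proj2_sig a))) (proj2 (proj2 (proj2_sig b))).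
Qed.
Definition gh x y z (f f' : ghom x y) (g g' : ghom y z) (a : gcell f f') (b : gcell g g') :
  gcell (gm f g) (gm f' g') := exist _ _ (gh_proof a b).

Lemma gu_proof (x : hom X (C0 C)) : c ∘ (e ∘ x) = x /\ d ∘ (e ∘ x) = x.
Proof. by rewrite !compA gde gce comp1m. Qed.
Definition gu x : ghom x x := exist _ _ (gu_proof x).

Section Restrict.
Variables (Y : ob K) (f g : hom Y (C1 C)) (a : cell Y (C1 C)) (p : hom X Y).

(** All the structure cells below are restrictions of structure 2-cells along
an induced 1-cell [p], and are typed by this lemma. *)
Lemma gcell_restr x y (f' g' : ghom x y) (u v : hom Y (C0 C)) :
  a ∈ f ⇒ g -> c ◃ a = 𝟙 u -> d ◃ a = 𝟙 v ->
  f ∘ p = proj1_sig f' -> g ∘ p = proj1_sig g' -> u ∘ p = x -> v ∘ p = y ->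
  a ▹ p ∈ proj1_sig f' ⇒ proj1_sig g' /\ c ◃ (a ▹ p) = 𝟙 x /\ d ◃ (a ▹ p) = 𝟙 y.
Proof.
move=> [sa ta] ca da <- <- <- <-; rewrite !hcompA ca da !hcomp_idc; split=> //.
by split; rewrite ?src_hcomp ?tgt_hcomp ?src_idc ?tgt_idc ?sa ?ta.
Qed.
End Restrict.

Lemma vinv_type (Y : ob K) (f g : hom Y (C1 C)) (a : cell Y (C1 C)) :
  invertible a -> a ∈ f ⇒ g -> a⁻¹ ∈ g ⇒ f.
Proof. by move=> /vinvP [T _] [<- <-]. Qed.

Section Assoc.
Variables (x y z w : hom X (C0 C)) (f : ghom x y) (g : ghom y z) (h : ghom z w).
Let p : hom X (C3 C) := ⟨proj1_sig f, proj1_sig g, proj1_sig h⟩.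

Lemma assoc_src : m ∘ ⟨p31 C, m ∘ ⟨p32 C, p33 C⟩⟩ ∘ p = proj1_sig (gm f (gm g h)).
Proof.
have [E1 [E2 E3]] := pair3P (ghom_match f g) (ghom_match g h).
have [K1 K2] := pb3_comm (C3P C); have [M1 M2] := pair2P K2.
rewrite -compA pair2_comp; last by rewrite -compA pair2_comp // E1 E2 E3.
by rewrite compA gc_mul -compA M1.
Qed.

Lemma assoc_tgt : m ∘ ⟨m ∘ ⟨p31 C, p32 C⟩, p33 C⟩ ∘ p = proj1_sig (gm (gm f g) h).
Proof.
have [E1 [E2 E3]] := pair3P (ghom_match f g) (ghom_match g h).
have [K1 K2] := pb3_comm (C3P C); have [M1 M2] := pair2P K1.
rewrite -compA pair2_comp; last by rewrite -compA pair2_comp // E1 E2 E3.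
by rewrite compA gd_mul -compA M2.
Qed.

Lemma p31_ends : c ∘ p31 C ∘ p = x.
Proof.
have [E1 _] := pair3P (ghom_match f g) (ghom_match g h).
by rewrite -compA E1; case: (f) => ? [].
Qed.
Lemma p33_ends : d ∘ p33 C ∘ p = w.
Proof.
have [_ [_ E1]] := pair3P (ghom_match f g) (ghom_match g h).
by rewrite -compA E1; case: (h) => ? [].
Qed.

Definition gasc : gcell (gm f (gm g h)) (gm (gm f g) h) :=
  exist _ _ (gcell_restr (assoc_type C) (gc_assoc C) (gd_assoc C)
    assoc_src assoc_tgt p31_ends p33_ends).

Definition gasci : gcell (gm (gm f g) h) (gm f (gm g h)) :=
  exist _ _ (gcell_restr (vinv_type (assoc_inv C) (assoc_type C))
    (vinv_wl (assoc_inv C) (gc_assoc C)) (vinv_wl (assoc_inv C) (gd_assoc C))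
    assoc_tgt assoc_src p31_ends p33_ends).
End Assoc.

Section Unit.
Variables (x y : hom X (C0 C)) (f : ghom x y).

Lemma lun_src : m ∘ ⟨e ∘ c, idm (C1 C)⟩ ∘ proj1_sig f = proj1_sig (gm (gu x) f).
Proof.
rewrite -compA pair2_comp; first by rewrite compA gde comp1m compm1.
by rewrite -compA comp1m; case: (f) => g [/= -> _].
Qed.
Lemma run_src : m ∘ ⟨idm (C1 C), e ∘ d⟩ ∘ proj1_sig f = proj1_sig (gm f (gu y)).
Proof.
rewrite -compA pair2_comp; first by rewrite compA gce comp1m compm1.
by rewrite -compA comp1m; case: (f) => g [/= _ ->].
Qed.

Let f1 := comp1m (proj1_sig f).
Let fc := proj1 (proj2_sig f).
Let fd := proj2 (proj2_sig f).

Definition glun : gcell (gm (gu x) f) f :=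
  exist _ _ (gcell_restr (lun_type C) (gc_lun C) (gd_lun C) lun_src f1 fc fd).
Definition grun : gcell (gm f (gu y)) f :=
  exist _ _ (gcell_restr (run_type C) (gc_run C) (gd_run C) run_src f1 fc fd).
Definition gluni : gcell f (gm (gu x) f) :=
  exist _ _ (gcell_restr (vinv_type (lun_inv C) (lun_type C))
    (vinv_wl (lun_inv C) (gc_lun C)) (vinv_wl (lun_inv C) (gd_lun C)) f1 lun_src fc fd).
Definition gruni : gcell f (gm f (gu y)) :=
  exist _ _ (gcell_restr (vinv_type (run_inv C) (run_type C))
    (vinv_wl (run_inv C) (gc_run C)) (vinv_wl (run_inv C) (gd_run C)) f1 run_src fc fd).
End Unit.

Lemma vinvK_wr (Y : ob K) (a : cell Y (C1 C)) (f g : hom Y (C1 C)) (p : hom X Y) :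
  invertible a -> a ∈ f ⇒ g ->
  (a⁻¹ ▹ p) · (a ▹ p) = 𝟙 (f ∘ p) /\ (a ▹ p) · (a⁻¹ ▹ p) = 𝟙 (g ∘ p).
Proof.
move=> /vinvP [[s t] [E1 E2]] [sa ta].
by rewrite -!wr_vcomp ?s ?t // E1 E2 sa ta !hcomp_idc.
Qed.

End GeneralizedElements.

(** ** Restriction of generalized elements *)

(** These are equations between underlying 2-cells because the endpoints of the
two sides are equal, but not convertible. *)
Section Restriction.
Variables (K : TwoCat) (C : PseudoCat K) (X Y : ob K) (p : hom Y X).

Lemma gv_restr x y (f g h : @ghom K C X x y) (b : gcell g h) (a : gcell f g) :
  proj1_sig (gv b a) ▹ p = (proj1_sig b ▹ p) · (proj1_sig a ▹ p).
Proof. by rewrite /= wr_vcomp // tgt_gcell src_gcell. Qed.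

Lemma gm_restr x y z (f : @ghom K C X x y) (g : ghom y z) :
  proj1_sig (gm f g) ∘ p = mul C ∘ ⟨proj1_sig f ∘ p, proj1_sig g ∘ p⟩.
Proof. by rewrite /= -compA pair2_comp //; apply: ghom_match. Qed.

Lemma gh_restr x y z (f f' : @ghom K C X x y) (g g' : ghom y z) (a : gcell f f')
    (b : gcell g g') :
  proj1_sig (gh a b) ▹ p = mul C ◃ ⟪proj1_sig a ▹ p, proj1_sig b ▹ p⟫.
Proof. by rewrite /= -hcompA cpair2_wr //; apply: gcell_match. Qed.

Lemma gasc_restr x y z w (f : @ghom K C X x y) (g : ghom y z) (h : ghom z w) :
  proj1_sig (gasc f g h) ▹ p
  = assoc C ▹ ⟨proj1_sig f ∘ p, proj1_sig g ∘ p, proj1_sig h ∘ p⟩.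
Proof. by rewrite /= wr_comp pair3_comp //; apply: ghom_match. Qed.

Lemma gasci_restr x y z w (f : @ghom K C X x y) (g : ghom y z) (h : ghom z w) :
  proj1_sig (gasci f g h) ▹ p
  = (assoc C)⁻¹ ▹ ⟨proj1_sig f ∘ p, proj1_sig g ∘ p, proj1_sig h ∘ p⟩.
Proof. by rewrite /= wr_comp pair3_comp //; apply: ghom_match. Qed.
End Restriction.

(** ** The axioms of a bicategory *)

Section LocalBicat.
Variables (K : TwoCat) (C : PseudoCat K) (X : ob K).
Local Notation d := (gd C).
Local Notation c := (gc C).
Local Notation e := (ge C).
Local Notation m := (mul C).
Local Notation α := (assoc C).
Implicit Types x y z w v : hom X (C0 C).

Lemma gvA x y (f g h k : @ghom K C X x y) (a3 : gcell h k) (a2 : gcell g h) (a1 : gcell f g) :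
  gv (gv a3 a2) a1 = gv a3 (gv a2 a1).
Proof. by apply: gcell_eq; rewrite /= vcompA // tgt_gcell src_gcell. Qed.

Lemma gv1l x y (f g : @ghom K C X x y) (a : gcell f g) : gv (gid g) a = a.
Proof. by case: a => a [[s t] ?]; apply: gcell_eq; rewrite /= -t vcomp1c. Qed.

Lemma gv1r x y (f g : @ghom K C X x y) (a : gcell f g) : gv a (gid f) = a.
Proof. by case: a => a [[s t] ?]; apply: gcell_eq; rewrite /= -s vcompc1. Qed.

Lemma gh1 x y z (f : @ghom K C X x y) (g : ghom y z) : gh (gid f) (gid g) = gid (gm f g).
Proof. by apply: gcell_eq; rewrite /= cpair2_idc ?hcomp_idc //; apply: ghom_match. Qed.

Lemma ghv x y z (f f' f'' : @ghom K C X x y) (g g' g'' : ghom y z)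
    (a' : gcell f' f'') (a : gcell f f') (b' : gcell g' g'') (b : gcell g g') :
  gh (gv a' a) (gv b' b) = gv (gh a' b') (gh a b).
Proof.
have E := gcell_match a b; have E' := gcell_match a' b'.
apply: gcell_eq; rewrite /= cpair2_vcomp ?tgt_gcell ?src_gcell //.
by rewrite wl_vcomp // tgt_cpair2 ?src_cpair2 // !tgt_gcell !src_gcell.
Qed.

Lemma gascK x y z w (f : @ghom K C X x y) (g : ghom y z) (h : ghom z w) :
  gv (gasci f g h) (gasc f g h) = gid _.
Proof.
apply: gcell_eq; rewrite /= (proj1 (vinvK_wr _ (assoc_inv C) (assoc_type C))).
by rewrite assoc_src.
Qed.

Lemma gasciK x y z w (f : @ghom K C X x y) (g : ghom y z) (h : ghom z w) :
  gv (gasc f g h) (gasci f g h) = gid _.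
Proof.
apply: gcell_eq; rewrite /= (proj2 (vinvK_wr _ (assoc_inv C) (assoc_type C))).
by rewrite assoc_tgt.
Qed.

Lemma glunK x y (f : @ghom K C X x y) : gv (gluni f) (glun f) = gid _.
Proof.
apply: gcell_eq; rewrite /= (proj1 (vinvK_wr _ (lun_inv C) (lun_type C))).
by rewrite lun_src.
Qed.

Lemma grunK x y (f : @ghom K C X x y) : gv (gruni f) (grun f) = gid _.
Proof.
apply: gcell_eq; rewrite /= (proj1 (vinvK_wr _ (run_inv C) (run_type C))).
by rewrite run_src.
Qed.

Lemma gluniK x y (f : @ghom K C X x y) : gv (glun f) (gluni f) = gid _.
Proof.
apply: gcell_eq; rewrite /= (proj2 (vinvK_wr _ (lun_inv C) (lun_type C))).
by rewrite comp1m.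
Qed.

Lemma gruniK x y (f : @ghom K C X x y) : gv (grun f) (gruni f) = gid _.
Proof.
apply: gcell_eq; rewrite /= (proj2 (vinvK_wr _ (run_inv C) (run_type C))).
by rewrite comp1m.
Qed.

(** Naturality of [α] is the interchange of [α] with the 2-cell induced by
[a1], [a2], [a3]. *)
Lemma assoc_natural (a1 a2 a3 : cell X (C1 C)) :
  d ◃ a1 = c ◃ a2 -> d ◃ a2 = c ◃ a3 ->
  (α ▹ ⟨tgt a1, tgt a2, tgt a3⟩) · (m ◃ ⟪a1, m ◃ ⟪a2, a3⟫⟫)
  = (m ◃ ⟪m ◃ ⟪a1, a2⟫, a3⟫) · (α ▹ ⟨src a1, src a2, src a3⟩).
Proof.
move=> E E'; have [U1 [U2 U3]] := cpair3P E E'.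
have [K1 K2] := pb3_comm (C3P C); have [s t] := assoc_type C.
have M1 : d ∘ p31 C = c ∘ (m ∘ ⟨p32 C, p33 C⟩).
  by rewrite compA gc_mul -compA (proj1 (pair2P K2)).
have M2 : d ∘ (m ∘ ⟨p31 C, p32 C⟩) = c ∘ p33 C.
  by rewrite compA gd_mul -compA (proj2 (pair2P K1)).
rewrite -src_cpair3 // -tgt_cpair3 //; have := hcomp_srctgt α ⟪a1, a2, a3⟫.
rewrite hcomp_tgtsrc s t -!wl_comp !cpair2_wl // -!wl_comp !cpair2_wl //.
by rewrite U1 U2 U3 => <-.
Qed.

Lemma gasc_nat x y z w (f f' : @ghom K C X x y) (g g' : ghom y z) (h h' : ghom z w)
    (a1 : gcell f f') (a2 : gcell g g') (a3 : gcell h h') :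
  gv (gasc f' g' h') (gh a1 (gh a2 a3)) = gv (gh (gh a1 a2) a3) (gasc f g h).
Proof.
have := assoc_natural (gcell_match a1 a2) (gcell_match a2 a3).
by rewrite !src_gcell !tgt_gcell => E; apply: gcell_eq.
Qed.

Lemma glun_nat x y (f f' : @ghom K C X x y) (a : gcell f f') :
  gv (glun f') (gh (gid (gu x)) a) = gv a (glun f).
Proof.
case: a => a [[sa ta] [ca da]]; apply: gcell_eq; rewrite /= -sa -ta.
have [s t] := lun_type C; have := hcomp_srctgt (lun C) a.
rewrite hcomp_tgtsrc s t hcomp1c => ->.
rewrite -wl_comp cpair2_wl; first by rewrite compA gde comp1m compm1.
by rewrite -wl_comp ca hcomp_idc hcomp1c.
Qed.

Lemma grun_nat x y (f f' : @ghom K C X x y) (a : gcell f f') :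
  gv (grun f') (gh a (gid (gu y))) = gv a (grun f).
Proof.
case: a => a [[sa ta] [ca da]]; apply: gcell_eq; rewrite /= -sa -ta.
have [s t] := run_type C; have := hcomp_srctgt (run C) a.
rewrite hcomp_tgtsrc s t hcomp1c => ->.
rewrite -wl_comp cpair2_wl; first by rewrite compA gce comp1m compm1.
by rewrite -wl_comp da hcomp_idc hcomp1c.
Qed.
End LocalBicat.

Section Coherence.
Variables (K : TwoCat) (C : PseudoCat K) (X : ob K).

(** The two ways of making a 1-cell an arrow that are used for projections:
the second lets the codomain be the given domain of a preceding projection. *)
Definition arrow (Y : ob K) (f : hom Y (C1 C)) : ghom (gc C ∘ f) (gd C ∘ f) :=
  exist _ f (conj eq_refl eq_refl).
Definition arrow_from (Y : ob K) (f : hom Y (C1 C)) x (E : x = gc C ∘ f) : ghom x (gd C ∘ f) :=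
  exist _ f (conj (eq_sym E) eq_refl).

(** The pentagon of [C] is the case of the four projections of [C4]; the general
case is its restriction along [⟨k, f, g, h⟩]. *)
Lemma gpentagon x y z w v (k : @ghom K C X x y) (f : ghom y z) (g : ghom z w) (h : ghom w v) :
  gv (gasc (gm k f) g h) (gasc k f (gm g h))
  = gv (gh (gasc k f g) (gid h)) (gv (gasc k (gm f g) h) (gh (gid k) (gasc f g h))).
Proof.
have [E1 [E2 E3]] := pb4_comm (C4P C).
pose P1 := arrow (p41 C); pose P2 := arrow_from E1; pose P3 := arrow_from E2.
pose P4 := arrow_from E3.
have P : gv (gasc (gm P1 P2) P3 P4) (gasc P1 P2 (gm P3 P4))
  = gv (gv (gh (gasc P1 P2 P3) (gid P4)) (gasc P1 (gm P2 P3) P4)) (gh (gid P1) (gasc P2 P3 P4)).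
  by apply: gcell_eq; exact: (pentagon C).
pose q := ⟨proj1_sig k, proj1_sig f, proj1_sig g, proj1_sig h⟩.
have [Q1 [Q2 [Q3 Q4]]] := pair4P (ghom_match k f) (ghom_match f g) (ghom_match g h).
apply: gcell_eq; move/(f_equal (fun a => proj1_sig a ▹ q)): P.
rewrite gvA !gv_restr !gh_restr !gasc_restr !gm_restr /= !hcomp_idc.
by rewrite Q1 Q2 Q3 Q4.
Qed.

Lemma gtriangle x y z (f : @ghom K C X x y) (g : ghom y z) :
  gv (gh (grun f) (gid g)) (gasc f (gu y) g) = gh (gid f) (glun g).
Proof.
have E := pb2_comm (C2P C).
pose P1 := arrow (p21 C); pose P2 := arrow_from E.
have P : gv (gh (grun P1) (gid P2)) (gasc P1 (gu _) P2) = gh (gid P1) (glun P2).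
  by apply: gcell_eq; rewrite /= E compA; exact: (triangle C).
pose q := ⟨proj1_sig f, proj1_sig g⟩.
have [Q1 Q2] := pair2P (ghom_match f g).
apply: gcell_eq; move/(f_equal (fun a => proj1_sig a ▹ q)): P.
rewrite !gv_restr !gh_restr !gasc_restr /= !wr_comp !hcomp_idc -!compA Q1 Q2.
by rewrite (proj2 (proj2_sig f)).
Qed.

Definition local_bicat : Bicat :=
  @Build_Bicat (hom X (C0 C)) (@ghom K C X) (@gcell K C X) (@gid K C X) (@gv K C X)
    (@gm K C X) (@gh K C X) (@gu K C X) (@gasc K C X) (@gasci K C X)
    (@glun K C X) (@gluni K C X) (@grun K C X) (@gruni K C X)
    (@gvA K C X) (@gv1l K C X) (@gv1r K C X) (@gh1 K C X) (@ghv K C X)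
    (@gascK K C X) (@gasciK K C X) (@gasc_nat K C X) (@glunK K C X) (@grunK K C X)
    (@gluniK K C X) (@gruniK K C X) (@glun_nat K C X) (@grun_nat K C X) gpentagon gtriangle.
End Coherence.

Section Iso.
Variables (K : TwoCat) (C : PseudoCat K) (X : ob K) (x y : hom X (C0 C)).
Variables (f g : @ghom K C X x y).

Lemma biso_invertible (a : gcell f g) :
  biso (B := local_bicat C X) a <-> invertible (proj1_sig a).
Proof.
split=> [[b [E1 E2]]|/vinvP [T [E1 E2]]].
  exists (proj1_sig b); split; first by rewrite /has_type !src_gcell !tgt_gcell.
  move/(f_equal (@proj1_sig _ _)): E1; move/(f_equal (@proj1_sig _ _)): E2.
  by rewrite src_gcell tgt_gcell.
have ia : invertible (proj1_sig a) by exists (proj1_sig a)⁻¹.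
case: (a) T E1 E2 ia => a' [T' [ca da]] /= T E1 E2 ia.
pose b : gcell g f :=
  exist _ _ (conj (vinv_type ia T') (conj (vinv_wl ia ca) (vinv_wl ia da))).
exists b.
have [s t] := T'; by split; apply: gcell_eq; rewrite /= ?E1 ?E2 ?s ?t.
Qed.
End Iso.

(** * Pseudo-functors and transformations on generalized elements *)

Section Functor.
Variables (K : TwoCat) (C C' : PseudoCat K) (F : PseudoFunctor C C') (X : ob K).

Lemma Fhom_proof x y (f : @ghom K C X x y) :
  gc C' ∘ (F1 F ∘ proj1_sig f) = F0 F ∘ x /\ gd C' ∘ (F1 F ∘ proj1_sig f) = F0 F ∘ y.
Proof.
by case: f => f [fc fd] /=; rewrite !compA gc_F1 gd_F1 -!compA fc fd.
Qed.
Definition Fhom x y (f : @ghom K C X x y) : @ghom K C' X (F0 F ∘ x) (F0 F ∘ y) :=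
  exist _ _ (Fhom_proof f).

Section Mu.
Variables (x y z : hom X (C0 C)) (f : ghom x y) (g : ghom y z).
Let p : hom X (C2 C) := ⟨proj1_sig f, proj1_sig g⟩.

Lemma mu_src : F1 F ∘ mul C ∘ p = proj1_sig (Fhom (gm f g)).
Proof. by rewrite -compA. Qed.

Lemma mu_tgt : mul C' ∘ ⟨F1 F ∘ p21 C, F1 F ∘ p22 C⟩ ∘ p
  = proj1_sig (gm (Fhom f) (Fhom g)).
Proof.
have [E1 E2] := pair2P (ghom_match f g).
rewrite -compA pair2_comp; first by rewrite !compA gd_F1 gc_F1 -!compA (pb2_comm (C2P C)).
by rewrite -!compA E1 E2.
Qed.

Lemma mu_gc : F0 F ∘ gc C ∘ p21 C ∘ p = F0 F ∘ x.
Proof.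
by rewrite -!compA (proj1 (pair2P (ghom_match f g))) (proj1 (proj2_sig f)).
Qed.

Lemma mu_gd : F0 F ∘ gd C ∘ p22 C ∘ p = F0 F ∘ z.
Proof.
by rewrite -!compA (proj2 (pair2P (ghom_match f g))) (proj2 (proj2_sig g)).
Qed.

Definition gmu : gcell (Fhom (gm f g)) (gm (Fhom f) (Fhom g)) :=
  exist _ _ (gcell_restr (mu_type F) (gc_mu F) (gd_mu F) mu_src mu_tgt mu_gc mu_gd).

Definition gmui : gcell (gm (Fhom f) (Fhom g)) (Fhom (gm f g)) :=
  exist _ _ (gcell_restr (vinv_type (mu_inv F) (mu_type F)) (vinv_wl (mu_inv F) (gc_mu F))
    (vinv_wl (mu_inv F) (gd_mu F)) mu_tgt mu_src mu_gc mu_gd).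

Lemma gmuK : gv gmui gmu = gid _.
Proof.
apply: gcell_eq; rewrite /= (proj1 (vinvK_wr _ (mu_inv F) (mu_type F))).
by rewrite mu_src.
Qed.
End Mu.

Lemma eps_src x : F1 F ∘ ge C ∘ x = proj1_sig (Fhom (gu x)).
Proof. by rewrite -compA. Qed.
Lemma eps_tgt (x : hom X (C0 C)) : ge C' ∘ F0 F ∘ x = proj1_sig (gu (C := C') (F0 F ∘ x)).
Proof. by rewrite -compA. Qed.

Definition geps (x : hom X (C0 C)) : gcell (Fhom (gu x)) (gu (F0 F ∘ x)) :=
  exist _ _ (gcell_restr (eps_type F) (gc_eps F) (gd_eps F) (eps_src x) (eps_tgt x)
    eq_refl eq_refl).
End Functor.

Section Transformation.
Variables (K : TwoCat) (C C' : PseudoCat K) (F G : PseudoFunctor C C') (T : PseudoNat F G).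

Section Components.
Variable X : ob K.

Lemma component_proof (x : hom X (C0 C)) :
  gc C' ∘ (tr1 T ∘ x) = F0 G ∘ x /\ gd C' ∘ (tr1 T ∘ x) = F0 F ∘ x.
Proof. by rewrite !compA (gc_tr1 (transP T)) (gd_tr1 (transP T)). Qed.
Definition component (x : hom X (C0 C)) : @ghom K C' X (F0 G ∘ x) (F0 F ∘ x) :=
  exist _ _ (component_proof x).

Section Square.
Variables (x y : hom X (C0 C)) (f : ghom x y).

Lemma square_src : mul C' ∘ ⟨F1 G, tr1 T ∘ gd C⟩ ∘ proj1_sig f
  = proj1_sig (gm (Fhom G f) (component y)).
Proof.
rewrite -compA pair2_comp; first by rewrite compA (gc_tr1 (transP T)) gd_F1.
by rewrite -compA (proj2 (proj2_sig f)).
Qed.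

Lemma square_tgt : mul C' ∘ ⟨tr1 T ∘ gc C, F1 F⟩ ∘ proj1_sig f
  = proj1_sig (gm (component x) (Fhom F f)).
Proof.
rewrite -compA pair2_comp; first by rewrite compA (gd_tr1 (transP T)) gc_F1.
by rewrite -compA (proj1 (proj2_sig f)).
Qed.

Lemma square_gc : gc C' ∘ F1 G ∘ proj1_sig f = F0 G ∘ x.
Proof. by rewrite -compA (proj1 (Fhom_proof G f)). Qed.
Lemma square_gd : gd C' ∘ F1 F ∘ proj1_sig f = F0 F ∘ y.
Proof. by rewrite -compA (proj2 (Fhom_proof F f)). Qed.

Definition square : gcell (gm (Fhom G f) (component y)) (gm (component x) (Fhom F f)) :=
  exist _ _ (gcell_restr (tr2_type (transP T)) (gc_tr2 (transP T)) (gd_tr2 (transP T))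
    square_src square_tgt square_gc square_gd).
End Square.
End Components.

(** The universal composable pair of arrows of [C]. *)
Definition arrow1 : @ghom K C (C2 C) _ _ := arrow (p21 C).
Definition arrow2 : @ghom K C (C2 C) _ _ := arrow_from (pb2_comm (C2P C)).

Lemma pair2_id : ⟨p21 C, p22 C⟩ = idm (C2 C).
Proof. by rewrite -[RHS]pair2_eta !compm1. Qed.

Lemma square_mul :
  gv (gasc (component (gc C ∘ p21 C)) (Fhom F arrow1) (Fhom F arrow2))
    (gv (gh (gid (component (gc C ∘ p21 C))) (gmu F arrow1 arrow2))
      (gv (square (gm arrow1 arrow2))
        (gh (gmui G arrow1 arrow2) (gid (component (gd C ∘ p22 C))))))
  = hpaste (B := local_bicat C' (C2 C)) (square arrow1) (square arrow2).
Proof.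
rewrite /hpaste -!bvA -!gvA.
apply: gcell_eq.
rewrite /= pair2_id !hcompc1 compm1 (pb2_comm (C2P C)) !compA.
exact: (tr2_mul (transP T)).
Qed.

Lemma square_unit : let o := idm (C0 C) in
  gv (glun (component o)) (gh (geps G o) (gid (component o)))
  = gv (grun (component o)) (gv (gh (gid (component o)) (geps F o)) (square (gu o))).
Proof.
rewrite /= -gvA; apply: gcell_eq.
rewrite /= !hcompc1 !compm1.
exact: (tr2_unit (transP T)).
Qed.
End Transformation.

(** * The vertical composite *)

Section Composite.
Variables (K : TwoCat) (C C' : PseudoCat K) (F G H : PseudoFunctor C C').
Variables (T : PseudoNat F G) (S : PseudoNat G H).

Definition pasting X x y (f : @ghom K C X x y) :=
  vpaste (B := local_bicat C' X) (square S f) (square T f).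

Definition generic_arrow : @ghom K C (C1 C) (gc C) (gd C) :=
  exist _ (idm (C1 C)) (conj (compm1 _) (compm1 _)).

Lemma otimes_pasting : tr2 (S ⊗ T) = proj1_sig (pasting generic_arrow).
Proof. by rewrite /pasting /vpaste -!bvA /= !hcompc1 !compm1. Qed.

Lemma components_match : gd C' ∘ tr1 S = gc C' ∘ tr1 T.
Proof. by rewrite (gd_tr1 (transP S)) (gc_tr1 (transP T)). Qed.

(** Every generalized arrow of [C] is a restriction of the identity of [C1], so
the defining formula of [S ⊗ T] gives the pasting at every stage [X]. *)
Lemma otimes_wr X x y (f : @ghom K C X x y) :
  tr2 (S ⊗ T) ▹ proj1_sig f = proj1_sig (pasting f).
Proof.
rewrite otimes_pasting /pasting /vpaste !gv_restr !gasc_restr gasci_restr !gh_restr.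
rewrite /= !hcompc1 !hcomp_idc !compm1 -!compA.
by rewrite (proj1 (proj2_sig f)) (proj2 (proj2_sig f)).
Qed.

Lemma otimes_mul :
    let s := tr1 (S ⊗ T) in let σ := tr2 (S ⊗ T) in
    let π1 := p21 C in let π2 := p22 C in
    (assoc C' ▹ ⟨s ∘ gc C ∘ π1, F1 F ∘ π1, F1 F ∘ π2⟩)
      · (mul C' ◃ ⟪𝟙 (s ∘ gc C ∘ π1), mu F⟫)
      · (σ ▹ mul C)
      · (mul C' ◃ ⟪(mu H)⁻¹, 𝟙 (s ∘ gd C ∘ π2)⟫)
    = (mul C' ◃ ⟪σ ▹ π1, 𝟙 (F1 F ∘ π2)⟫)
      · (assoc C' ▹ ⟨F1 H ∘ π1, s ∘ gc C ∘ π2, F1 F ∘ π2⟩)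
      · (mul C' ◃ ⟪𝟙 (F1 H ∘ π1), σ ▹ π2⟫)
      · ((assoc C')⁻¹ ▹ ⟨F1 H ∘ π1, F1 H ∘ π2, s ∘ gd C ∘ π2⟩).
Proof.
move=> s σ π1 π2.
pose f1 := arrow1 C; pose f2 := arrow2 C.
have E := vpaste_mul (B := local_bicat C' (C2 C)) (h1 := Fhom H f1) (h2 := Fhom H f2)
  (g1 := Fhom G f1) (g2 := Fhom G f2) (f1 := Fhom F f1) (f2 := Fhom F f2)
  (μg := gmu G f1 f2) (gmuK G f1 f2) (square_mul S) (square_mul T).
(* only the outer composites are rebracketed: the pasted squares stay whole *)
rewrite /hpaste -[LHS]bvA -[LHS]bvA -[RHS]bvA -[RHS]bvA in E.
move/(f_equal (@proj1_sig _ _)): E.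
rewrite /σ.
have M : proj1_sig (gm (arrow1 C) (arrow2 C)) = mul C by rewrite /= pair2_id compm1.
rewrite -{1}M -[π1]/(proj1_sig (arrow1 C)) -[π2]/(proj1_sig (arrow2 C)) !otimes_wr.
rewrite /= /s /= -!compA !(pair2_comp _ components_match) pair2_id !hcompc1.
by rewrite -(pb2_comm (C2P C)).
Qed.

Lemma otimes_unit :
    let s := tr1 (S ⊗ T) in let σ := tr2 (S ⊗ T) in
    (lun C' ▹ s) · (mul C' ◃ ⟪eps H, 𝟙 s⟫)
    = (run C' ▹ s) · (mul C' ◃ ⟪𝟙 s, eps F⟫) · (σ ▹ ge C).
Proof.
move=> s σ; pose o := idm (C0 C).
have E := vpaste_unit (B := local_bicat C' (C0 C)) (εh := geps H o) (εf := geps F o)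
  (square_unit S) (square_unit T).
rewrite -[RHS]bvA in E; move/(f_equal (@proj1_sig _ _)): E.
have M : proj1_sig (gu (C := C) o) = ge C by rewrite /= compm1.
rewrite /σ -M otimes_wr /= !hcompc1 /s /=.
by rewrite /o !compm1.
Qed.
End Composite.

Theorem theorem2 (K : TwoCat) (C C' : PseudoCat K) (F G H : PseudoFunctor C C')
    (T : PseudoNat F G) (S : PseudoNat G H) :
  is_pseudo_nat F H (S ⊗ T).
Proof.
have E := otimes_pasting T S; have M := components_match T S; split.
- by rewrite /= compA gd_mul -compA (proj2 (pair2P M)) (gd_tr1 (transP T)).
- by rewrite /= compA gc_mul -compA (proj1 (pair2P M)) (gc_tr1 (transP S)).
- have [T' _] := proj2_sig (pasting T S (generic_arrow C)); rewrite E; move: T'.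
  by rewrite /= !compm1 -!compA !(pair2_comp _ M).
- rewrite E; apply/biso_invertible/biso_vpaste; apply/biso_invertible => /=.
    by rewrite hcompc1; apply: tr2_inv (transP S).
  by rewrite hcompc1; apply: tr2_inv (transP T).
- by rewrite E (proj2 (proj2 (proj2_sig (pasting T S (generic_arrow C))))) gd_F1.
- by rewrite E (proj1 (proj2 (proj2_sig (pasting T S (generic_arrow C))))) gc_F1.
- exact: otimes_mul.
- exact: otimes_unit.
Qed.
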